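(* Let $\mathbb{F}$ be an algebraically closed field, let $d \geq 3$ be an integer, and let $\Phi$ be a Leonard system over $\mathbb{F}$ with diameter $d$ and parameter array $(\{\theta_i\}_{i=0}^d, \{\theta^*_i\}_{i=0}^d, \{\varphi_i\}_{i=1}^d, \{\phi_i\}_{i=1}^d)$. Assume $\varphi_1 + \varphi_d = \phi_1 + \phi_d$. Then there exist infinitely many mutually non-isomorphic Leonard systems over $\mathbb{F}$ with diameter $d$ that have the same fundamental parameter and the same end-entries as $\Phi$.
   Context: Let $\mathbb{F}$ be an algebraically closed field, $d\ge 0$ an integer, and $V$ a vector space over $\mathbb{F}$ of dimension $d+1$. A square matrix is tridiagonal if every nonzero entry lies on the diagonal, the subdiagonal or the superdiagonal; a tridiagonal matrix is irreducible if all entries on the subdiagonal and on the superdiagonal are nonzero. A Leonard pair on $V$ is an ordered pair of linear maps $A: V\to V$, $A^*: V\to V$ ($A^*$ is just a second map, not an adjoint) such that (i) there is a basis of $V$ with respect to which the matrix of $A$ is irreducible tridiagonal and the matrix of $A^*$ is diagonal; (ii) there is a basis of $V$ with respect to which the matrix of $A^*$ is irreducible tridiagonal and the matrix of $A$ is diagonal. It is known that each of $A, A^*$ then has $d+1$ mutually distinct eigenvalues. The primitive idempotent of $A$ associated with an eigenvalue $\theta$ is the linear map acting as the identity on the $\theta$-eigenspace and as $0$ on the other eigenspaces; similarly for $A^*$. An ordering $\{E_i\}_{i=0}^d$ of the primitive idempotents of $A$ is standard if, for nonzero $v_i\in E_iV$, the basis $\{v_i\}_{i=0}^d$ satisfies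 (ii) (i.e. $A^*$ is irreducible tridiagonal with respect to it); an ordering $\{E^*_i\}_{i=0}^d$ of the primitive idempotents of $A^*$ is standard if, for nonzero $v^*_i\in E^*_iV$, the basis $\{v^*_i\}_{i=0}^d$ satisfies (i). A Leonard system on $V$ (over $\mathbb{F}$, with diameter $d$) is a sequence $\Phi=(A,\{E_i\}_{i=0}^d,A^*,\{E^*_i\}_{i=0}^d)$ where $A,A^*$ is a Leonard pair on $V$ and $\{E_i\}_{i=0}^d$, $\{E^*_i\}_{i=0}^d$ are standard orderings of the primitive idempotents of $A$, $A^*$ respectively. An isomorphism from $\Phi$ to a Leonard system $\Phi'=(A',\{E'_i\}_{i=0}^d,A^{*\prime},\{E^{*\prime}_i\}_{i=0}^d)$ on $V'$ is a linear bijection $\sigma:V\to V'$ with $\sigma A=A'\sigma$, $\sigma A^*=A^{*\prime}\sigma$, $\sigma E_i=E'_i\sigma$, $\sigma E^*_i=E^{*\prime}_i\sigma$ for $0\le i\le d$; $\Phi,\Phi'$ are isomorphic if such $\sigma$ exists. The parameter array of $\Phi$ is $(\{\theta_i\}_{i=0}^d,\{\theta^*_i\}_{i=0}^d,\{\varphi_i\}_{i=1}^d,\{\phi_i\}_{i=1}^d)$, where $\theta_i$ (resp. $\theta^*_i$) is the eigenvalue of $A$ (resp. $A^*$) associated with $E_i$ (resp. $E^*_i$), and for $1\le i\le d$ \[ \varphi_i=(\theta^*_0-\theta^*_i)\frac{\mathrm{tr}(E^*_0\prod_{h=0}^{i-1}(A-\theta_hI))}{\mathrm{tr}(E^*_0\prod_{h=0}^{i-2}(A-\theta_hI))},\qquad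 \phi_i=(\theta^*_0-\theta^*_i)\frac{\mathrm{tr}(E^*_0\prod_{h=0}^{i-1}(A-\theta_{d-h}I))}{\mathrm{tr}(E^*_0\prod_{h=0}^{i-2}(A-\theta_{d-h}I))}, \] with empty products equal to the identity $I$ (the denominators are known to be nonzero). For $d\ge 3$ it is known that the expressions $\frac{\theta_{i-2}-\theta_{i+1}}{\theta_{i-1}-\theta_i}$ and $\frac{\theta^*_{i-2}-\theta^*_{i+1}}{\theta^*_{i-1}-\theta^*_i}$ are equal and independent of $i$ for $2\le i\le d-1$; the fundamental parameter $\beta$ of $\Phi$ is one less than this common value. The principal sequence of $\Phi$ is $\{a_i\}_{i=0}^d$ with $a_i=\mathrm{tr}(AE^*_i)$, and the dual principal sequence is $\{a^*_i\}_{i=0}^d$ with $a^*_i=\mathrm{tr}(A^*E_i)$. The end-entries of $\Phi$ are $\theta_0,\theta_d,\theta^*_0,\theta^*_d,a_0,a_d,a^*_0,a^*_d$; two Leonard systems of diameter $d$ have the same end-entries if these eight scalars coincide respectively. *)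

(* Defs.v *)
From mathcomp Require Import all_boot all_algebra.
From mathcomp Require Import boolp classical_sets.

Set Implicit Arguments.
Unset Strict Implicit.
Unset Printing Implicit Defensive.

Import GRing.Theory.

Local Open Scope ring_scope.

Definition tridiagonal (F : fieldType) (n : nat) (M : 'M[F]_n) : Prop :=
  forall i j : 'I_n, M i j != 0 ->
    [\/ i = j, i = j.+1 :> nat | j = i.+1 :> nat].

Definition irreducible_tridiagonal (F : fieldType) (n : nat) (M : 'M[F]_n) :
    Prop :=
  tridiagonal M /\
  forall i j : 'I_n, (i = j.+1 :> nat \/ j = i.+1 :> nat) -> M i j != 0.

Section LinearMaps.
Variables (F : fieldType) (V : vectType F).

(* Column convention: f b_j = \sum_i M i j *: b_i.  The library's passmx.mxof acts on
   row vectors and is the transpose of this. *)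
Definition lfun_mx (n : nat) (b : n.-tuple V) (f : 'End(V)) : 'M[F]_n :=
  \matrix_(i, j) coord b i (f (tnth b j)).

Definition lfun_trace (f : 'End(V)) : F := \tr (lfun_mx (vbasis {:V}) f).

Definition leonard_basis (n : nat) (f g : 'End(V)) (b : n.-tuple V) : Prop :=
  [/\ basis_of {:V} b, irreducible_tridiagonal (lfun_mx b f)
    & is_diag_mx (lfun_mx b g)].

Definition leonard_pair (A As : 'End(V)) : Prop :=
  (exists b : (\dim {:V}).-tuple V, leonard_basis A As b) /\
  (exists b : (\dim {:V}).-tuple V, leonard_basis As A b).

Definition primitive_idempotent (f : 'End(V)) (t : F) (E : 'End(V)) : Prop :=
  [/\ passmx.leigenvalue f t,
      forall v : V, v \in passmx.leigenspace f t -> E v = v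
    & forall (s : F) (v : V),
        passmx.leigenvalue f s -> s != t -> v \in passmx.leigenspace f s -> E v = 0].

(* An enumeration, without repetition, of all primitive idempotents of f. *)
Definition idempotent_ordering (f : 'End(V)) (n : nat) (E : 'I_n -> 'End(V)) :
    Prop :=
  injective E /\
  forall X : 'End(V),
    (exists t : F, primitive_idempotent f t X) <-> (exists i : 'I_n, E i = X).

Definition standard_ordering (f g : 'End(V)) (n : nat) (E : 'I_n -> 'End(V)) :
    Prop :=
  idempotent_ordering f E /\
  forall v : n.-tuple V,
    (forall i : 'I_n, tnth v i != 0 /\ tnth v i \in limg (E i)) ->
    leonard_basis g f v.

(* The set is a singleton when E is a primitive idempotent of a diagonalizable
   f; the default 0 is then irrelevant. *)
Definition associated_eigenvalue (f E : 'End(V)) : F :=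
  xget 0 [set t : F | primitive_idempotent f t E].

End LinearMaps.

Record leonard_system (F : closedFieldType) (d : nat) := LeonardSystem {
  ls_space :> vectType F;
  ls_dim : \dim {:ls_space} = d.+1;
  ls_A : 'End(ls_space);
  ls_E : 'I_d.+1 -> 'End(ls_space);
  ls_As : 'End(ls_space);
  ls_Es : 'I_d.+1 -> 'End(ls_space);
  ls_pair : leonard_pair ls_A ls_As;
  ls_standard : standard_ordering ls_A ls_As ls_E;
  ls_dual_standard : standard_ordering ls_As ls_A ls_Es
}.

Definition ls_isomorphic (F : closedFieldType) (d : nat)
    (Phi Psi : leonard_system F d) : Prop :=
  exists sigma : 'Hom(Phi, Psi),
    [/\ bijective sigma,
        (sigma \o ls_A Phi)%VF = (ls_A Psi \o sigma)%VF,
        (sigma \o ls_As Phi)%VF = (ls_As Psi \o sigma)%VF,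
        forall i : 'I_d.+1,
          (sigma \o ls_E Phi i)%VF = (ls_E Psi i \o sigma)%VF
      & forall i : 'I_d.+1,
          (sigma \o ls_Es Phi i)%VF = (ls_Es Psi i \o sigma)%VF].

(* Scalars are indexed by nat to keep index arithmetic out of ordinals; they
   are meaningful for i <= d only (inord i is then the i-th ordinal), and for
   1 <= i <= d in the case of ls_varphi and ls_phi. *)
Section LeonardScalars.
Variables (F : closedFieldType) (d : nat) (Phi : leonard_system F d).

Definition ls_theta (i : nat) : F :=
  associated_eigenvalue (ls_A Phi) (ls_E Phi (inord i)).

Definition ls_thetas (i : nat) : F :=
  associated_eigenvalue (ls_As Phi) (ls_Es Phi (inord i)).

Definition ls_a (i : nat) : F :=
  lfun_trace (ls_A Phi \o ls_Es Phi (inord i))%VF.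

Definition ls_as (i : nat) : F :=
  lfun_trace (ls_As Phi \o ls_E Phi (inord i))%VF.

Definition split_trace (t : nat -> F) (k : nat) : F :=
  lfun_trace
    (ls_Es Phi ord0
      \o \big[@comp_lfun F Phi Phi Phi / \1%VF]_(0 <= h < k)
           (ls_A Phi - t h *: \1))%VF.

Definition ls_varphi (i : nat) : F :=
  (ls_thetas 0 - ls_thetas i) *
  (split_trace ls_theta i / split_trace ls_theta i.-1).

Definition ls_phi (i : nat) : F :=
  (ls_thetas 0 - ls_thetas i) *
  (split_trace (fun h => ls_theta (d - h)) i
     / split_trace (fun h => ls_theta (d - h)) i.-1).

(* For 3 <= d the set is a singleton; the default 0 is then irrelevant. *)
Definition ls_beta : F :=
  xget 0 [set b : F | forall i : nat, (2 <= i <= d.-1)%N ->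
    (ls_theta (i - 2) - ls_theta i.+1) / (ls_theta i.-1 - ls_theta i) = b + 1
    /\
    (ls_thetas (i - 2) - ls_thetas i.+1) / (ls_thetas i.-1 - ls_thetas i)
      = b + 1].

Definition ls_end_entries : seq F :=
  [:: ls_theta 0; ls_theta d; ls_thetas 0; ls_thetas d;
      ls_a 0; ls_a d; ls_as 0; ls_as d].

End LeonardScalars.

(* Main.v *)
From HB Require Import structures.
Require Import Defs.
From mathcomp Require Import all_boot all_algebra.
From mathcomp Require Import boolp classical_sets.
From mathcomp Require Import zify ring.

(** The varphi_i and phi_i with i = 1 or d are products of differences of
    end-entries and eigenvalues, and the hypothesis turns out to say
    theta_0 - theta_1 = theta_d - theta_(d-1) and
    theta*_0 - theta*_1 = theta*_d - theta*_(d-1).  Combined with the recurrence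
    of parameter beta this forces
      theta_i = theta_0 + (theta_d - theta_0) r_i
                + (theta_1 - theta_0) (r_i + U_i)
    and the same for theta*, where r and U depend on beta only, r_d = 1 and
    r_i + U_i vanishes for i = 0 and i = d.  Multiplying theta_1 - theta_0,
    theta*_1 - theta*_0 and phi_1 by a scalar t therefore preserves beta and the
    extreme eigenvalues, while theta_1 changes with t.  The split scalars become
    polynomials in t which do not vanish identically: for i = 1 or d they are
    nonzero multiples of t, and otherwise their value at t = 0 is a nonzero
    multiple of r_i (r_(i-1) - 1), a zero of which would make two eigenvalues
    coincide.  So all but finitely many t give a parameter array, hence a Leonard
    system, and the remaining end-entries are determined by relations homogeneous
    of degree one in t. *)

Set Implicit Arguments.
Unset Strict Implicit.
Unset Printing Implicit Defensive.

Import GRing.Theory.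

Local Open Scope ring_scope.

(** The hard step leads from an array to a Leonard system. A split form, with A lower and A* upper
    bidiagonal, exists for any scalars; what needs proof is that A* is irreducible tridiagonal in an
    eigenbasis of A. Seen from one ordering of the eigenvalues A* is only Hessenberg. The other half
    comes from the reversed ordering, whose split form must be shown to give the same map. An
    Askey-Wilson relation common to both achieves this: it confines the difference of corresponding
    rows to the roots of a quadratic, and the first two split vectors then force the difference to
    vanish.

    The family exists because, once the end differences are equal, the relations between end-entries
    contain theta_1 - theta_0 and theta*_1 - theta*_0 only through their ratio. Outside
    characteristic 2, r_i is (1 - U_i + U_(i-1)) / 2; defining r by a recurrence with constant e
    avoids the division. *)

Section LinearCombination.
Variable R : comPzRingType.
Implicit Types x y l r k : R.

(** Certificates for [ring]: an equation follows once the difference of its sides is an explicit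
    combination of the differences of known equations. *)
Lemma lincomb1 l1 r1 (h1 : l1 = r1) k1 x y :
  x - y = k1 * (l1 - r1) -> x = y.
Proof. by rewrite h1 subrr mulr0 => /subr0_eq. Qed.

Lemma lincomb2 l1 r1 l2 r2 (h1 : l1 = r1) (h2 : l2 = r2) k1 k2 x y :
  x - y = k1 * (l1 - r1) + k2 * (l2 - r2) -> x = y.
Proof. by rewrite h1 h2 !subrr !mulr0 addr0 => /subr0_eq. Qed.

Lemma lincomb3 l1 r1 l2 r2 l3 r3 (h1 : l1 = r1) (h2 : l2 = r2) (h3 : l3 = r3)
    k1 k2 k3 x y :
  x - y = k1 * (l1 - r1) + k2 * (l2 - r2) + k3 * (l3 - r3) -> x = y.
Proof. by rewrite h1 h2 h3 !subrr !mulr0 !addr0 => /subr0_eq. Qed.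

Lemma lincomb4 l1 r1 l2 r2 l3 r3 l4 r4 (h1 : l1 = r1) (h2 : l2 = r2)
    (h3 : l3 = r3) (h4 : l4 = r4) k1 k2 k3 k4 x y :
  x - y = k1 * (l1 - r1) + k2 * (l2 - r2) + k3 * (l3 - r3) + k4 * (l4 - r4) ->
  x = y.
Proof. by rewrite h1 h2 h3 h4 !subrr !mulr0 !addr0 => /subr0_eq. Qed.

End LinearCombination.

Arguments lincomb1 {R l1 r1} h1 k1 {x y}.
Arguments lincomb2 {R l1 r1 l2 r2} h1 h2 k1 k2 {x y}.
Arguments lincomb3 {R l1 r1 l2 r2 l3 r3} h1 h2 h3 k1 k2 k3 {x y}.
Arguments lincomb4 {R l1 r1 l2 r2 l3 r3 l4 r4} h1 h2 h3 h4 k1 k2 k3 k4 {x y}.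

(** * Sequences *)

Section Recurrence.
Variable F : fieldType.
Implicit Types (b e : F) (n i : nat).

Fixpoint rec2 b e (u v : F) n : F :=
  if n is n'.+1 then rec2 b e v (b * v - u + e) n' else u.

Lemma rec2SS b e u v n :
  rec2 b e u v n.+2 = b * rec2 b e u v n.+1 - rec2 b e u v n + e.
Proof. by elim: n u v => [|n IHn] u v //=; rewrite -IHn. Qed.

(* Indices are shifted by one: [chebU e n] is U_(n-1), starting from U_(-1) = -1,
   [symr e n] is r_(n-1) and, below, [tseq e a S x n] is theta_(n-1); the parameter
   [e] encodes beta = 2 - 2 e, which keeps characteristic 2 on the same footing. *)
Definition chebU e := rec2 (2 - (e + e)) 0 (-1) 0.
Definition symr e := rec2 (2 - (e + e)) e e 0.

Lemma chebUSS e n :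
  chebU e n.+2 = (2 - (e + e)) * chebU e n.+1 - chebU e n.
Proof. by rewrite /chebU rec2SS addr0. Qed.

Lemma symrSS e n :
  symr e n.+2 = (2 - (e + e)) * symr e n.+1 - symr e n + e.
Proof. exact: rec2SS. Qed.

Lemma double_symr e n : symr e n.+1 + symr e n.+1 = 1 - chebU e n.+1 + chebU e
  n.
Proof.
suff [] : symr e n.+1 + symr e n.+1 = 1 - chebU e n.+1 + chebU e n /\
  symr e n.+2 + symr e n.+2 = 1 - chebU e n.+2 + chebU e n.+1 by [].
elim: n => [|n [IH1 IH2]]; first by rewrite /chebU /symr /=; split; ring.
split=> //; rewrite symrSS (chebUSS e n.+1).
apply: (lincomb3 IH1 IH2 (chebUSS e n) (-1) (2 - (e + e)) (-1)); ring.
Qed.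

(** Rewritten with the recurrence: r increases by e U_n from index n to n + 1. *)
Lemma symr_pred e n :
  symr e n + (1 - (2 - (e + e))) * symr e n.+1 = e * (1 - chebU e n.+1).
Proof.
suff [] : symr e n + (1 - (2 - (e + e))) * symr e n.+1 = e * (1 - chebU e n.+1)
  /\ symr e n.+1 + (1 - (2 - (e + e))) * symr e n.+2 = e * (1 - chebU e n.+2).
  by [].
elim: n => [|n [IH1 IH2]]; first by rewrite /chebU /symr /=; split; ring.
split=> //; rewrite (symrSS e n.+1) (chebUSS e n.+1).
apply: (lincomb3 IH1 IH2 (symrSS e n) (-1) (2 - (e + e)) 1); ring.
Qed.

(** The Casoratian of r and U, corrected for the constant e in the recurrence of r. It makes [vphi]
    symmetric in A and A*, and restricts U where r is 0 or 1. *)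
Lemma symr_chebU_wronskian e n :
  symr e n.+1 + chebU e n.+1 + symr e n.+1 * chebU e n - symr e n * chebU e n.+1
  = 1 + chebU e n.
Proof.
elim: n => [|n IHn]; first by rewrite /chebU /symr /=; ring.
rewrite symrSS chebUSS.
apply: (lincomb2 IHn (symr_pred e n) 1 (-1)); ring.
Qed.

Lemma symr_eq0 e n : e != 0 -> symr e n.+1 = 0 ->
  chebU e n.+1 = 0 \/ chebU e n.+1 = 1.
Proof.
move=> e0 r0.
have : e * (chebU e n.+1 * (1 - chebU e n.+1)) = 0.
  have h1 := double_symr e n; have h2 := symr_pred e n.
  have h3 := symr_chebU_wronskian e n; rewrite r0 in h1 h2 h3.
  by apply: (lincomb3 h1 h2 h3 1 (- chebU e n.+1) (-1)); ring.
move/eqP; rewrite !mulf_eq0 (negPf e0) /= subr_eq0 eq_sym.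
by case/orP => /eqP; [left | right].
Qed.

Lemma symr_eq1 e n : e != 0 -> symr e n.+1 = 1 ->
  chebU e n.+1 = 0 \/ chebU e n.+1 = -1.
Proof.
move=> e0 r1.
have : e * (chebU e n.+1 * (chebU e n.+1 + 1)) = 0.
  have h2 := symr_pred e n.
  have h3 := symr_chebU_wronskian e n; rewrite r1 in h2 h3.
  by apply: (lincomb2 h2 h3 (chebU e n.+1) 1); ring.
move/eqP; rewrite !mulf_eq0 (negPf e0) /= addr_eq0.
by case/orP => /eqP; [left | right].
Qed.

Definition tseq e a S x n := a + S * symr e n + x * (symr e n + chebU e n).
(** When theta_d = a + S, the sum in parentheses is theta_1 + theta_d. [kappa] and [rho] are the
    scalars gamma and varrho of the Askey-Wilson relation. *)
Definition kappa e a S x : F := e * (a + a + S + x).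

Lemma tseqSS e a S x n :
  tseq e a S x n.+2
  = (2 - (e + e)) * tseq e a S x n.+1 - tseq e a S x n + kappa e a S x.
Proof. by rewrite /tseq symrSS chebUSS /kappa; ring. Qed.

Lemma tseq0 e a S x : tseq e a S x 0 = a + S * e + x * (e - 1).
Proof. by []. Qed.

Lemma tseq1 e a S x : tseq e a S x 1 = a.
Proof. by rewrite /tseq /symr /chebU /=; ring. Qed.

Lemma tseq2 e a S x : tseq e a S x 2 = a + x.
Proof. by rewrite /tseq /symr /chebU /=; ring. Qed.

Definition rho e a S x : F :=
  a ^+ 2 - (2 - (e + e)) * a * (a + x) + (a + x) ^+ 2
  - kappa e a S x * (a + a + x).

(** A first integral: consecutive left sides differ by the recurrence times the difference of its
    two outer terms. *)
Lemma tseq_rho e a S x n :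
  tseq e a S x n ^+ 2 - (2 - (e + e)) * tseq e a S x n * tseq e a S x n.+1
  + tseq e a S x n.+1 ^+ 2 - kappa e a S x * (tseq e a S x n + tseq e a S x
    n.+1)
  = rho e a S x.
Proof.
elim: n => [|n <-]; first by rewrite tseq0 tseq1 /rho /kappa; ring.
by rewrite tseqSS; ring.
Qed.

(* First split sequence for theta = (a, S, x), theta* = (as_, Ss, xs) and phi_1 = c:
   the factor [1 + chebU e n] is the sum of (theta_h - theta_(d-h)) / (theta_0 -
   theta_d) over h < n.  The second split sequence is that of the reversed
   parameters (a + S, - S, x), with c - xs S in place of c. *)
Definition vphi e a S x as_ Ss xs c n : F :=
  c * (1 + chebU e n)
  + (tseq e as_ Ss xs n.+1 - as_) * (tseq e a S x n - (a + S)).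

(** [omega] and [eta] are the values that the subdiagonal and diagonal identities below force at n =
    0. *)
Definition omega e a S x as_ Ss xs c : F :=
  let b := 2 - (e + e) in
  c * (2 - b) + (2 - b) * as_ * (a + S) - as_ * kappa e a S x
  - (a + S) * kappa e as_ Ss xs
  + (as_ * a - as_ * (a + x) + (1 - b) * (as_ + xs) * a + (as_ + xs) * (a + x)
     - kappa e a S x * (as_ + xs) - kappa e as_ Ss xs * a).

Definition eta e a S x as_ Ss xs c : F :=
  let b := 2 - (e + e) in
  (2 * a ^+ 2 - b * a ^+ 2 - 2 * kappa e a S x * a - rho e a S x) * as_
  + ((1 - b) * a + (a + x) - kappa e a S x) * (c - xs * S)
  - kappa e as_ Ss xs * a ^+ 2 - omega e a S x as_ Ss xs c * a.

Section AskeyWilson.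
Variables (e a S x as_ Ss xs c : F).
Local Notation b := (2 - (e + e)).
Local Notation t := (tseq e a S x).
Local Notation ts := (tseq e as_ Ss xs).
Local Notation kp := (kappa e a S x).
Local Notation kps := (kappa e as_ Ss xs).
Local Notation vp := (vphi e a S x as_ Ss xs c).
Local Notation om := (omega e a S x as_ Ss xs c).

Lemma vphi0 : vp 0 = 0.
Proof. by rewrite /vphi tseq1 /chebU /=; ring. Qed.

Lemma vphi1 : vp 1 = c - xs * S.
Proof. by rewrite /vphi tseq1 tseq2 /chebU /=; ring. Qed.

(* The next two identities are the subdiagonal and diagonal parts, in the split
   basis, of the Askey-Wilson relation
     A^2 A* - b A A* A + A* A^2 - kp (A A* + A* A) - rho A* = kps A^2 + om A + eta. *)
Lemma askey_wilson_sub n :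
  ts n.+1 * (t n.+1 + t n.+2) + vp n + ts n.+2 * (t n.+1 + t n.+2) + vp n.+2
  - b * (t n.+1 * ts n.+1 + ts n.+2 * t n.+2 + vp n.+1)
  - kp * (ts n.+1 + ts n.+2)
  = kps * (t n.+1 + t n.+2) + om.
Proof.
(* The terms of the identity that vary with n collect into [G], which the two recurrences keep
   constant. *)
pose G n := ts n.+1 * t n.+1 - ts n.+1 * t n.+2 + (1 - b) * ts n.+2 * t n.+1
            + ts n.+2 * t n.+2 - kp * ts n.+2 - kps * t n.+1.
have GE m : G m = G 0.
  elim: m => [//|m <-]; rewrite /G.
  by rewrite !(tseqSS _ _ _ _ m.+1); ring.
have := GE n; rewrite /G tseq1 tseq2 tseq1 tseq2 => {}GE.
rewrite /vphi /omega chebUSS !(tseqSS _ _ _ _ n.+1).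
have tE : t n = b * t n.+1 - t n.+2 + kp by rewrite tseqSS; ring.
rewrite tE; apply: (lincomb1 GE 1); ring.
Qed.

Lemma askey_wilson_diag n :
  (2 * t n.+1 ^+ 2 - b * t n.+1 ^+ 2 - 2 * kp * t n.+1 - rho e a S x) * ts n.+1
  + ((1 - b) * t n.+1 + t n.+2 - kp) * vp n.+1 + (t n.+1 - t n.+2) * vp n
  - kps * t n.+1 ^+ 2 - om * t n.+1 = eta e a S x as_ Ss xs c.
Proof.
elim: n => [|n <-].
  by rewrite vphi0 vphi1 !tseq1 !tseq2 /eta; ring.
(* The left sides at n + 1 and n differ by the subdiagonal identity times theta_(n+1) - theta_n plus
   the first integral times theta*_(n+1) - theta*_n. *)
have h1 := askey_wilson_sub n; have h2 := tseq_rho e a S x n.+1.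
rewrite !(tseqSS _ _ _ _ n.+1).
apply: (lincomb2 h1 h2 (t n.+2 - t n.+1) (ts n.+2 - ts n.+1)); ring.
Qed.
End AskeyWilson.

(** Duality: exchanging A and A* fixes the first split sequence and replaces phi_1 by phi_d, which
    is c - xs S + Ss x. *)
Lemma vphi_dual e a S x as_ Ss xs c n :
  vphi e a S x as_ Ss xs c n
  = vphi e as_ Ss xs a S x (c - xs * S + Ss * x) n.
Proof.
have h := symr_chebU_wronskian e n.
rewrite /vphi /tseq; apply: (lincomb1 h (Ss * x - S * xs)); ring.
Qed.

(** Reversing the eigenvalues of A preserves its Askey-Wilson relation, so the two split forms can
    be compared. *)
Lemma omega_rev e a S x as_ Ss xs c :
  omega e (a + S) (- S) x as_ Ss xs (c - xs * S) = omega e a S x as_ Ss xs c.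
Proof. by rewrite /omega /kappa; ring. Qed.

Lemma eta_rev e a S x as_ Ss xs c :
  eta e (a + S) (- S) x as_ Ss xs (c - xs * S) = eta e a S x as_ Ss xs c.
Proof. by rewrite /eta omega_rev /omega /rho /kappa; ring. Qed.

End Recurrence.

(** * Split forms *)

Section Tau.
Variable F : fieldType.
Implicit Types (th ths vp : nat -> F) (d k : nat).

Definition tau th k (y : F) := \prod_(h < k) (y - th h).

Lemma tau0 th y : tau th 0 y = 1.
Proof. by rewrite /tau big_ord0. Qed.

Lemma tauS th k y : tau th k.+1 y = tau th k y * (y - th k).
Proof. by rewrite /tau big_ord_recr. Qed.

Lemma tau_eq0 th k i : (i < k)%N -> tau th k (th i) = 0.
Proof.
by move=> ik; rewrite /tau (bigD1 (Ordinal ik)) //= subrr mul0r.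
Qed.

Definition inj_upto d th :=
  forall i j, (i <= d)%N -> (j <= d)%N -> th i = th j -> i = j.

Lemma tau_neq0 th d k : inj_upto d th -> (k <= d)%N -> tau th k (th k) != 0.
Proof.
move=> inj kd; apply/prodf_neq0 => /= h _; rewrite subr_eq0.
have hk := ltn_ord h; apply/eqP => /inj -/(_ kd (ltnW (leq_trans hk kd))) E.
by move: hk; rewrite -E ltnn.
Qed.

(** Column k is the split vector tau_k(A) v in coordinates of an A-eigenbasis, where v has all
    coordinates 1. In the split basis A is [lower_mx] and A* is [upper_mx]. *)
Definition tau_mx d th : 'M[F]_d.+1 := \matrix_(i, k) tau th k (th i).

Lemma tau_mx_unit d th : inj_upto d th -> tau_mx d th \in unitmx.
Proof.
move=> inj; rewrite unitmxE det_trig; last first.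
  by apply/is_trig_mxP => i j ij; rewrite mxE tau_eq0.
rewrite unitfE; apply/prodf_neq0 => i _.
by rewrite mxE (tau_neq0 inj) // -ltnS.
Qed.

Lemma tau_free d th (v : 'I_d.+1 -> F) : inj_upto d th ->
  (forall k, (k <= d)%N -> \sum_i v i * tau th k (th i) = 0) ->
  forall i, v i = 0.
Proof.
move=> inj v0 i.
have : (\row_i v i) *m tau_mx d th = 0.
  apply/rowP => k; rewrite !mxE -[RHS](v0 k) -1?ltnS //.
  by apply: eq_bigr => j _; rewrite !mxE.
move/(congr1 (mulmx^~ (invmx (tau_mx d th)))).
rewrite mulmxK ?tau_mx_unit // mul0mx => /rowP/(_ i).
by rewrite !mxE.
Qed.

Definition upper_mx d ths vp : 'M[F]_d.+1 :=
  \matrix_(i, k) (ths k *+ (i == k) + vp k *+ (k == i.+1 :> nat)).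

(** The image of the k-th split vector under A*, at the eigenvalue y of A. For k = 0 the second term
    is spurious, whence the condition [vp 0 = 0] below. *)
Definition split_eval th ths vp k y :=
  ths k * tau th k y + vp k * tau th k.-1 y.

Lemma tau_mul_upper d th ths vp (j k : 'I_d.+1) : vp 0 = 0 ->
  (tau_mx d th *m upper_mx d ths vp) j k = split_eval th ths vp k (th j).
Proof.
move=> vp0; rewrite mxE (eq_bigr (fun i : 'I_d.+1 =>
  (tau th i (th j) * ths k) *+ (i == k) +
  (tau th i (th j) * vp k) *+ (k == i.+1 :> nat))); last first.
  by move=> i _; rewrite !mxE mulrDr !mulrnAr.
rewrite big_split /= (bigD1 k) //= eqxx mulr1n big1 ?addr0; last first.
  by move=> i /negPf ->.
rewrite /split_eval mulrC; congr (_ + _).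
case: (posnP k) => [k0|kpos].
  by rewrite k0 vp0 mul0r big1 // => i _; rewrite mulr0 mul0rn.
have kd : (k.-1 < d.+1)%N by rewrite prednK // ltnW.
rewrite (bigD1 (Ordinal kd)) //= prednK // eqxx mulr1n big1 ?addr0 ?(mulrC _
  (vp k)) //.
move=> i ni; case: eqP => // ki; case/eqP: ni; apply: val_inj => /=.
by rewrite ki.
Qed.

End Tau.

Section AskeyWilsonMatrix.
Variables (F : fieldType) (e a S x as_ Ss xs c : F) (d : nat).
Local Notation b := (2 - (e + e)).
Local Notation t := (tseq e a S x).
Local Notation ts := (tseq e as_ Ss xs).
Local Notation th := (fun k => t k.+1).
Local Notation ths := (fun k => ts k.+1).
Local Notation kp := (kappa e a S x).
Local Notation kps := (kappa e as_ Ss xs).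
Local Notation vp := (vphi e a S x as_ Ss xs c).
Local Notation om := (omega e a S x as_ Ss xs c).
Local Notation et := (eta e a S x as_ Ss xs c).
Local Notation rh := (rho e a S x).
Local Notation ev := (split_eval th ths vp).

(** The row at eigenvalue y of the Askey-Wilson relation, applied to the k-th split vector: A on the
    left acts as y, A on the right sends tau_k to theta_k tau_k + tau_(k+1). *)
Lemma askey_wilson_eval k y :
  y ^+ 2 * ev k y - b * y * (t k.+1 * ev k y + ev k.+1 y)
  + (t k.+1 ^+ 2 * ev k y + (t k.+1 + t k.+2) * ev k.+1 y + ev k.+2 y)
  - kp * (y * ev k y + t k.+1 * ev k y + ev k.+1 y) - rh * ev k y
  = (kps * y ^+ 2 + om * y + et) * tau th k y.
Proof.
have E : vp k * tau th k y = vp k * (tau th k.-1 y * (y - t k)).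
  by case: k => [|k]; rewrite ?vphi0 ?mul0r ?tauS.
have h1 := askey_wilson_sub e a S x as_ Ss xs c k.
have h2 := askey_wilson_diag e a S x as_ Ss xs c k.
have h3 := tseq_rho e a S x k.
have tE : t k = b * t k.+1 - t k.+2 + kp by rewrite tseqSS; ring.
rewrite /split_eval /= !tauS !(tseqSS e as_ Ss xs k.+1) in E *.
rewrite !tE in h3 E.
set f := tau _ k.-1 y in E *; set g := tau _ k y in E *.
apply: (lincomb4 h1 h2 h3 E (g * (y - t k.+1)) g (vp k * f) (- (y - t k.+2))).
ring.
Qed.

Hypothesis inj : inj_upto d th.
Hypothesis vpd : vp d.+1 = 0.

Definition aw_poly y z := y ^+ 2 - b * y * z + z ^+ 2 - kp * (y + z) - rh.

Variable C : 'M[F]_d.+1.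
Hypothesis CT : C *m tau_mx d th = tau_mx d th *m upper_mx d ths vp.

Lemma split_row k (j : 'I_d.+1) :
  \sum_i C j i * tau th k (th i) = ev k (th j).
Proof.
have [kd|dk] := leqP k d.
  have := congr1 (fun X : 'M_d.+1 => X j (Ordinal (kd : k < d.+1)%N)) CT.
  rewrite tau_mul_upper ?vphi0 // mxE => <-.
  by apply: eq_bigr => i _; rewrite mxE.
rewrite big1 => [|i _]; last by rewrite tau_eq0 ?mulr0 // (leq_trans (ltn_ord
  i)).
rewrite /split_eval tau_eq0 ?(leq_trans (ltn_ord j)) // mulr0 add0r.
move: dk; rewrite leq_eqVlt => /orP[/eqP <-|dk]; first by rewrite vpd mul0r.
by rewrite tau_eq0 ?mulr0 // (leq_trans (ltn_ord j)) //; case: k dk.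
Qed.

(** The Askey-Wilson relation in an A-eigenbasis; testing its rows against the Newton polynomials
    tau_k reduces it to [askey_wilson_eval]. *)
Lemma askey_wilson_entry (i j : 'I_d.+1) :
  C j i * aw_poly (th j) (th i)
  = (kps * th j ^+ 2 + om * th j + et) *+ (i == j).
Proof.
apply/eqP; rewrite -subr_eq0; apply/eqP.
pose v (i : 'I_d.+1) := C j i * aw_poly (th j) (th i)
  - (kps * th j ^+ 2 + om * th j + et) *+ (i == j).
move: i; apply: (@tau_free _ _ _ v inj) => k kd.
rewrite (eq_bigr (fun i => C j i * aw_poly (th j) (th i) * tau th k (th i) -
   ((kps * th j ^+ 2 + om * th j + et) * tau th k (th i)) *+ (i == j)));
     last first.
  by move=> i _; rewrite /v mulrBl mulrnAl.
rewrite sumrB; apply/eqP; rewrite subr_eq0; apply/eqP.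
rewrite [RHS](bigD1 j) //= eqxx mulr1n [X in _ + X]big1 ?addr0; last first.
  by move=> i /negPf ->.
rewrite -askey_wilson_eval.
transitivity ((th j ^+ 2 - b * th j * t k.+1 + t k.+1 ^+ 2
  - kp * (th j + t k.+1) - rh) * ev k (th j)
  + (t k.+1 + t k.+2 - b * th j - kp) * ev k.+1 (th j) + ev k.+2 (th j));
  last by ring.
rewrite -!split_row !mulr_sumr -!big_split /=.
by apply: eq_bigr => i _; rewrite !tauS /aw_poly; ring.
Qed.

End AskeyWilsonMatrix.

(** A Vandermonde argument: the last hypothesis leaves at most two indices in the support of v, and
    there the moments 0 and 1 determine v. *)
Lemma quadratic_row_eq0 (F : fieldType) n (v th : 'I_n -> F) (p q : F) :
  injective th -> \sum_i v i = 0 -> \sum_i v i * th i = 0 ->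
  (forall i, v i * (th i ^+ 2 + p * th i + q) = 0) -> forall i, v i = 0.
Proof.
move=> inj s0 s1 vq i0; apply/eqP/negPn/negP => v0.
have root0 : th i0 ^+ 2 + p * th i0 + q = 0.
  by apply/eqP; move/eqP: (vq i0); rewrite mulf_eq0 (negPf v0).
(* The other root of the quadratic. If it differed from [th i0], the sum of v_i (th_i - r) would be
   nonzero. *)
set r := - p - th i0.
have vr i : i != i0 -> v i * (th i - r) = 0.
  move=> ni; have ti : th i - th i0 != 0.
    by rewrite subr_eq0; apply: contraNneq ni => /inj ->.
  apply: (mulIf ti); rewrite mul0r -[RHS](vq i).
  by apply: (lincomb1 root0 (- v i)); rewrite /r; ring.
have rE : th i0 = r.
  apply/eqP; rewrite -subr_eq0; move: (s1).
  have -> : \sum_i v i * th i = \sum_i v i * (th i - r).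
    under [RHS]eq_bigr => i _ do rewrite mulrBr.
    by rewrite sumrB -mulr_suml s0 mul0r subr0.
  by rewrite (bigD1 i0) //= big1 // addr0 => /eqP; rewrite mulf_eq0 (negPf v0).
move: s0; rewrite (bigD1 i0) //= big1 ?addr0 => [/eqP|i ni]; first exact/negP.
apply/eqP; move/eqP: (vr i ni); rewrite -rE mulf_eq0 subr_eq0 => /orP[//|/eqP].
by move/inj => E; rewrite E eqxx in ni.
Qed.

(** Since tau_k vanishes at theta_i for i < k, descending induction on k isolates C_jk in the k-th
    equation. Its right side at theta_j is 0 for j < k - 1 and varphi_k tau_(k-1)(theta_j) for j = k
    - 1. *)
Lemma split_hessenberg (F : fieldType) d (th ths vp : nat -> F) (C :
  'M[F]_d.+1) :
  inj_upto d th ->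
  (forall k, (0 < k <= d)%N -> vp k != 0) ->
  (forall k (j : 'I_d.+1), (k <= d)%N ->
     \sum_i C j i * tau th k (th i) = split_eval th ths vp k (th j)) ->
  forall j k : 'I_d.+1,
    ((j.+1 < k)%N -> C j k = 0) /\ (k = j.+1 :> nat -> C j k != 0).
Proof.
move=> inj vp0 CT j.
have step (k : 'I_d.+1) : (forall i : 'I_d.+1, (k < i)%N -> C j i = 0) ->
    C j k * tau th k (th k) = split_eval th ths vp k (th j).
  move=> C0; rewrite -CT -1?ltnS // (bigD1 k) //= big1 ?addr0 // => i.
  rewrite neq_ltn => /orP[ik|/C0 ->]; last by rewrite mul0r.
  by rewrite (tau_eq0 _ ik) mulr0.
have C0 m (k : 'I_d.+1) : (d - k < m)%N -> (j.+1 < k)%N -> C j k = 0.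
  elim: m k => // m IHm k dk jk.
  have tk : tau th k (th k) != 0 by rewrite (tau_neq0 inj) // -ltnS.
  apply: (mulIf tk); rewrite mul0r step.
    have jk1 : (j < k.-1)%N by rewrite -ltnS prednK // (leq_ltn_trans _ jk).
    by rewrite /split_eval (tau_eq0 _ jk1) tau_eq0 1?ltnW // !mulr0 addr0.
  move=> i ki; apply: IHm; last exact: ltn_trans ki.
  have := ltn_ord i; rewrite ltnS => id.
  by rewrite -ltnS; apply: leq_trans dk;
    rewrite ltnS ltn_sub2l // (leq_trans ki).
move=> k; split=> [jk|kE]; first by apply: (C0 (d - k).+1).
have : C j k * tau th k (th k) != 0.
  rewrite step => [|i ki]; last by apply: (C0 (d - i).+1) => //; rewrite -kE.
  rewrite /split_eval kE tau_eq0 // mulr0 add0r mulf_neq0 //.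
    by apply: vp0; rewrite /= -kE -ltnS.
  by rewrite /= (tau_neq0 inj) // -ltnS.
by apply: contraNN => /eqP ->; rewrite mul0r.
Qed.

Section Half.
Variables (F : fieldType) (e a S x as_ Ss xs c : F) (d : nat).
Local Notation t := (tseq e a S x).
Local Notation t' := (tseq e (a + S) (- S) x).
Local Notation ts := (tseq e as_ Ss xs).
Local Notation th := (fun k => t k.+1).
Local Notation th' := (fun k => t' k.+1).
Local Notation ths := (fun k => ts k.+1).
Local Notation vp := (vphi e a S x as_ Ss xs c).
Local Notation ph := (vphi e (a + S) (- S) x as_ Ss xs (c - xs * S)).

Hypothesis inj : inj_upto d th.
Hypothesis t_rev : forall i, (i <= d)%N -> t' i.+1 = t (d - i).+1.
Hypothesis vpd : vp d.+1 = 0.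
Hypothesis phd : ph d.+1 = 0.
Hypothesis vp_neq0 : forall k, (0 < k <= d)%N -> vp k != 0.
Hypothesis ph_neq0 : forall k, (0 < k <= d)%N -> ph k != 0.

Lemma inj_rev : inj_upto d th'.
Proof.
move=> i j id jd; rewrite !t_rev // => /inj.
rewrite !leq_subr => /(_ isT isT) /(congr1 (subn d)).
by rewrite !subKn.
Qed.

(* The split forms attached to an ordering of the eigenvalues of A and to its
   reversal satisfy the same Askey-Wilson relation and agree on two vectors, which
   makes them equal.  One is Hessenberg from above, the other from below. *)
Lemma split_tridiagonal (C : 'M[F]_d.+1) :
  C *m tau_mx d th = tau_mx d th *m upper_mx d ths vp ->
  irreducible_tridiagonal C.
Proof.
move=> CT.
pose C' := tau_mx d th' *m upper_mx d ths ph *m invmx (tau_mx d th').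
have CT' : C' *m tau_mx d th' = tau_mx d th' *m upper_mx d ths ph.
  by rewrite mulmxKV // tau_mx_unit //; apply: inj_rev.
have row := split_row vpd CT; have row' := split_row phd CT'.
have revE (i : 'I_d.+1) : t' (rev_ord i).+1 = t i.+1.
  by rewrite t_rev /= ?subSS ?leq_subr ?subKn // -ltnS.
have CE (j i : 'I_d.+1) : C j i = C' (rev_ord j) (rev_ord i).
  apply/eqP; rewrite -subr_eq0; apply/eqP.
  pose v i := C j i - C' (rev_ord j) (rev_ord i).
  have sum_rev f : \sum_i C' (rev_ord j) (rev_ord i) * f (t i.+1)
                   = \sum_i C' (rev_ord j) i * f (t' i.+1).
    rewrite [RHS](reindex_inj rev_ord_inj) /=.
    by apply: eq_bigr => k _; rewrite revE.
  have shift (g h : 'I_d.+1 -> F) z :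
      \sum_i g i * (h i - z) = \sum_i g i * h i - z * \sum_i g i.
    under eq_bigr => k _ do rewrite mulrBr.
    by rewrite sumrB -mulr_suml (mulrC z).
  have r0 : \sum_i C j i = as_.
    have := row 0 j; rewrite /split_eval vphi0 mul0r addr0 tau0 mulr1 tseq1 =>
      <-.
    by apply: eq_bigr => k _; rewrite tau0 mulr1.
  have r0' : \sum_i C' (rev_ord j) (rev_ord i) = as_.
    have := row' 0 (rev_ord j); rewrite -(sum_rev (fun y => tau th' 0 y)).
    rewrite /split_eval vphi0 mul0r addr0 tau0 mulr1 tseq1 => <-.
    by apply: eq_bigr => k _; rewrite tau0 mulr1.
  have tau1 th0 y : tau th0 1 y = y - th0 0 by rewrite tauS tau0 mul1r.
  have r1 : \sum_i C j i * (t i.+1 - a) = split_eval th ths vp 1 (t j.+1).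
    by rewrite -row; apply: eq_bigr => k _; rewrite tau1 tseq1.
  have r1' : \sum_i C' (rev_ord j) (rev_ord i) * (t i.+1 - (a + S))
      = split_eval th' ths ph 1 (t j.+1).
    rewrite -[in RHS]revE -row' -(sum_rev (fun y => tau th' 1 y)).
    by apply: eq_bigr => k _; rewrite tau1 tseq1.
  rewrite shift r0 /split_eval vphi1 tau0 tau1 tseq1 tseq2 in r1.
  rewrite shift r0' /split_eval vphi1 tau0 tau1 tseq1 tseq2 in r1'.
  (* Moments 0 and 1 of the row difference, supplied by the split vectors of index 0 and 1. *)
  have s0 : \sum_i v i = 0 by rewrite /v sumrB r0 r0' subrr.
  have s1 : \sum_i v i * t i.+1 = 0.
    under eq_bigr => k _ do rewrite mulrBl.
    by rewrite sumrB; apply: (lincomb2 r1 r1' 1 (-1)); ring.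
  apply: (quadratic_row_eq0 (p := - (2 - (e + e)) * t j.+1 - kappa e a S x)
    (q := t j.+1 ^+ 2 - kappa e a S x * t j.+1 - rho e a S x) _ s0 s1).
    by move=> i1 i2 /inj E; apply/val_inj/E; rewrite /= -ltnS.
  move=> k; rewrite /v.
  have h1 := askey_wilson_entry inj vpd CT k j.
  have h2 := askey_wilson_entry inj_rev phd CT' (rev_ord k) (rev_ord j).
  rewrite (inj_eq rev_ord_inj) !revE omega_rev eta_rev -h1 in h2.
  have kE : kappa e (a + S) (- S) x = kappa e a S x by rewrite /kappa; ring.
  have rE : rho e (a + S) (- S) x = rho e a S x by rewrite /rho /kappa; ring.
  by rewrite /aw_poly kE rE in h2; apply: (lincomb1 h2 (-1)); ring.
have up j k := split_hessenberg inj vp_neq0 (fun k j _ => row k j) j k.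
have lo j k := split_hessenberg inj_rev ph_neq0 (fun k j _ => row' k j) j k.
split=> [i j|i j [ij|ji]].
- have [uij _] := up i j; have [lij _] := lo (rev_ord i) (rev_ord j).
  rewrite -CE in lij => Cij.
  have := ltn_ord i; have := ltn_ord j; rewrite !ltnS => jd id.
  have [ji|ij|/val_inj ->] := ltngtP j i; last by constructor 1.
    constructor 2; apply/eqP; rewrite eqn_leq ji andbT leqNgt.
    apply: contraNN Cij => ji2; apply/eqP/lij => /=.
    by move: ji2; lia.
  constructor 3; apply/eqP; rewrite eqn_leq ij andbT leqNgt.
  by apply: contraNN Cij => ij2; apply/eqP/uij.
- rewrite CE; have [_] := lo (rev_ord i) (rev_ord j); apply.
  by have := ltn_ord i; rewrite /=; lia.
- by have [_] := up i j; apply.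
Qed.
End Half.

(** * From split forms to a pair of tridiagonal matrices *)

Section LeonardData.
Variables (F : fieldType) (d : nat).
Implicit Types (th ths vp : nat -> F) (M C P X : 'M[F]_d.+1).

Definition diag_seq th : 'M[F]_d.+1 := diag_mx (\row_i th i).

Lemma mul_diag_seq th X i j : (diag_seq th *m X) i j = th i * X i j :> F.
Proof. by rewrite mul_diag_mx !mxE. Qed.

Lemma mul_seq_diag th X i j : (X *m diag_seq th) i j = X i j * th j :> F.
Proof. by rewrite mul_mx_diag !mxE. Qed.

(* In a basis of A*-eigenvectors, [M] is the matrix of A and the columns of [P]
   are A-eigenvectors; [C] is the matrix of A* in the basis of these columns. *)
Definition leonard_data th ths M C P : Prop :=
  [/\ P \in unitmx, irreducible_tridiagonal M, irreducible_tridiagonal C,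
      M *m P = P *m diag_seq th & diag_seq ths *m P = P *m C].

Lemma irreducible_tridiagonal_tr M :
  irreducible_tridiagonal M -> irreducible_tridiagonal M^T.
Proof.
move=> [tri irr]; split=> i j; rewrite mxE.
  by move/tri => [->|->|->]; [constructor 1 | constructor 3 | constructor 2].
by case=> ij; apply: irr; [right | left].
Qed.

Definition lower_mx th : 'M[F]_d.+1 :=
  \matrix_(i, k) (th i *+ (i == k) + 1 *+ (i == k.+1 :> nat)).

Lemma diag_mul_tau th : diag_seq th *m tau_mx d th = tau_mx d th *m lower_mx th.
Proof.
apply/matrixP => i k; rewrite mul_diag_seq !mxE.
rewrite (eq_bigr (fun j : 'I_d.+1 => (tau th j (th i) * th j) *+ (j == k) +
   tau th j (th i) *+ (j == k.+1 :> nat))); last first.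
  by move=> j _; rewrite !mxE mulrDr !mulrnAr mulr1.
rewrite big_split /= (bigD1 k) //= eqxx mulr1n big1 ?addr0; last first.
  by move=> j /negPf ->.
have -> : \sum_(j < d.+1) tau th j (th i) *+ (j == k.+1 :> nat)
          = tau th k.+1 (th i).
  have [kd|dk] := ltnP k.+1 d.+1.
    rewrite (bigD1 (Ordinal kd)) //= eqxx mulr1n big1 ?addr0 // => j.
    by rewrite -val_eqE /= => /negPf ->.
  rewrite tau_eq0 ?(leq_trans (ltn_ord i)) // big1 // => j _.
  by rewrite ltn_eqF ?(leq_trans (ltn_ord j)).
by rewrite tauS; ring.
Qed.

Definition vprod vp i := \prod_(1 <= h < i.+1) vp h.

Lemma vprodS vp i : vprod vp i.+1 = vprod vp i * vp i.+1.
Proof. by rewrite /vprod big_nat_recr. Qed.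

(** Rescaling by the products varphi_1 ... varphi_i replaces the off-diagonal varphi_i by 1, turning
    A* into the transpose of its lower bidiagonal form in the dual split basis. *)
Lemma diag_vprod_upper ths vp :
  diag_seq (vprod vp) *m upper_mx d ths vp = (lower_mx ths)^T *m diag_seq
    (vprod vp).
Proof.
apply/matrixP => i k; rewrite mul_diag_seq mul_seq_diag !mxE.
rewrite (eq_sym k) mulrDr mulrDl !mulrnAr !mulrnAl mul1r; congr (_ + _).
  by case: eqP => [->|//]; rewrite mulrC.
by case: eqP => // ->; rewrite vprodS.
Qed.

Lemma upper_tr_diag_vprod th vp :
  diag_seq (vprod vp) *m lower_mx th = (upper_mx d th vp)^T *m diag_seq (vprod
    vp).
Proof.
apply/matrixP => i k; rewrite mul_diag_seq mul_seq_diag !mxE.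
rewrite (eq_sym k) mulrDr mulrDl !mulrnAr !mulrnAl mulr1; congr (_ + _).
  by case: eqP => [->|//]; rewrite mulrC.
by case: eqP => // ->; rewrite vprodS mulrC.
Qed.

End LeonardData.

Section Construction.
Variables (F : fieldType) (e a S x as_ Ss xs c : F) (d : nat).
Local Notation t := (tseq e a S x).
Local Notation ts := (tseq e as_ Ss xs).
Local Notation th := (fun k => t k.+1).
Local Notation ths := (fun k => ts k.+1).
Local Notation vp := (vphi e a S x as_ Ss xs c).
Local Notation cs := (c - xs * S + Ss * x).

Hypothesis d_gt0 : (0 < d)%N.
Hypotheses (inj : inj_upto d th) (injs : inj_upto d ths).
Hypotheses (Ud : chebU e d.+1 = -1) (rd : symr e d.+1 = 1).
Hypothesis t_rev : forall i, (i <= d)%N ->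
  tseq e (a + S) (- S) x i.+1 = t (d - i).+1.
Hypothesis ts_rev : forall i, (i <= d)%N ->
  tseq e (as_ + Ss) (- Ss) xs i.+1 = ts (d - i).+1.
Hypothesis vp_neq0 : forall k, (0 < k <= d)%N -> vp k != 0.
Hypothesis ph_neq0 : forall k, (0 < k <= d)%N ->
  vphi e (a + S) (- S) x as_ Ss xs (c - xs * S) k != 0.
Hypothesis phs_neq0 : forall k, (0 < k <= d)%N ->
  vphi e (as_ + Ss) (- Ss) xs a S x (cs - x * Ss) k != 0.

Lemma vphi_end a' S' x' as' Ss' xs' c' :
  vphi e a' S' x' as' Ss' xs' c' d.+1 = 0.
Proof. by rewrite /vphi /tseq Ud rd; ring. Qed.

(* The A*-eigenbasis is obtained from the A-eigenbasis of the dual parameters by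
   transposing and rescaling the split form, which exchanges A and A*. *)
Lemma leonard_data_exists : exists M C P : 'M[F]_d.+1,
  leonard_data th ths M C P /\ (a - M ord0 ord0) * xs = c - xs * S.
Proof.
pose T := tau_mx d th; pose Ts := tau_mx d ths.
have Tu : T \in unitmx by apply: tau_mx_unit.
have Tsu : Ts \in unitmx by apply: tau_mx_unit.
have Gu : Ts^T \in unitmx by rewrite unitmx_tr.
pose N := diag_seq d (vprod vp).
have Nu : N \in unitmx.
  rewrite unitmxE det_diag unitfE; apply/prodf_neq0 => i _; rewrite mxE /vprod.
  rewrite big_nat; elim/big_ind: _ => [||h hi]; first exact: oner_neq0.
    exact: mulf_neq0.
  by apply: vp_neq0; have := ltn_ord i; lia.
pose C := T *m upper_mx d ths vp *m invmx T.
pose Cs := Ts *m upper_mx d th vp *m invmx Ts.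
have CT : C *m T = T *m upper_mx d ths vp by rewrite mulmxKV.
have CsT : Cs *m Ts = Ts *m upper_mx d th vp by rewrite mulmxKV.
(* Chosen so that [Ts^T *m P *m T = N]: both equations required of [P] become intertwining relations
   of [N] with bidiagonal matrices. *)
pose P := invmx Ts^T *m N *m invmx T.
have GPT : Ts^T *m P *m T = N by rewrite /P !mulmxA mulmxV // mul1mx mulmxKV.
have cancel X Y : Ts^T *m X *m T = Ts^T *m Y *m T -> X = Y.
  move/(congr1 (fun Z => invmx Ts^T *m (Z *m invmx T))).
  by rewrite !mulmxK // !mulKmx.
have vpE k : vp k = vphi e as_ Ss xs a S x cs k by rewrite vphi_dual.
have upE : upper_mx d th vp = upper_mx d th (vphi e as_ Ss xs a S x cs).
  by apply/matrixP => i j; rewrite !mxE vpE.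
have irrCs : irreducible_tridiagonal Cs.
  apply: (@split_tridiagonal _ e as_ Ss xs a S x cs) => //;
    rewrite ?vphi_end //; last by rewrite -upE.
  by move=> k kd; rewrite -vpE vp_neq0.
have irrC : irreducible_tridiagonal C.
  by apply: (@split_tridiagonal _ e a S x as_ Ss xs c); rewrite ?vphi_end.
have Pu : P \in unitmx by rewrite /P !unitmx_mul !unitmx_inv Gu Nu.
clearbody P C Cs; exists Cs^T, C, P; split.
  split=> //; first exact: irreducible_tridiagonal_tr.
    apply: cancel; rewrite -!mulmxA diag_mul_tau !mulmxA GPT.
    rewrite -trmx_mul CsT trmx_mul -2!mulmxA (mulmxA _ P) GPT.
    by rewrite -upper_tr_diag_vprod.
  apply: cancel; rewrite -!mulmxA CT !mulmxA GPT diag_vprod_upper.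
  have -> : Ts^T *m diag_seq d ths = (diag_seq d ths *m Ts)^T.
    by rewrite trmx_mul tr_diag_mx.
  by rewrite diag_mul_tau trmx_mul -2!mulmxA (mulmxA _ P) GPT.
(* Row 0 of [Cs] has at most two nonzero entries; tested against tau_0 and tau_1 they give Cs_00 +
   Cs_01 = theta_0 and Cs_01 xs = varphi_1. *)
have row k := @split_row _ e as_ Ss xs a S x cs d (vphi_end _ _ _ _ _ _ _) Cs
  (etrans CsT (congr1 _ upE)) k ord0.
rewrite mxE; pose i1 : 'I_d.+1 := Ordinal (d_gt0 : 1 < d.+1)%N.
have Cs0 (i : 'I_d.+1) : (i != ord0) && (i != i1) -> Cs ord0 i = 0.
  case/andP => n0 n1; apply/eqP/negPn/negP => /(irrCs.1).
  case=> [E|//|E]; first by rewrite -E eqxx in n0.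
  by case/eqP: n1; apply: val_inj.
have := row 0; have := row 1.
rewrite (bigD1 ord0) // (bigD1 i1) //= big1 => [|i /Cs0 ->];
  last by rewrite mul0r.
rewrite (bigD1 ord0) // (bigD1 i1) //= big1 => [|i /Cs0 ->];
  last by rewrite mul0r.
rewrite /split_eval vphi0 vphi1 !tauS !tau0 !tseq1 tseq2 => h1 h0.
by apply: (lincomb2 h1 h0 1 (- xs)); ring.
Qed.

End Construction.

(** * Matrices of a Leonard system *)

Section Bases.
Variables (F : fieldType) (V : vectType F) (n : nat).
Implicit Types (b : n.-tuple V) (f g E : 'End(V)).

Lemma coord_tnth b : basis_of {:V} b ->
  forall i j : 'I_n, coord b i (tnth b j) = (i == j)%:R.
Proof.
by move=> /basis_free fb i j; rewrite (tnth_nth 0) coord_free // eq_sym.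
Qed.

Lemma coord_expand b : basis_of {:V} b ->
  forall v : V, v = \sum_i coord b i v *: tnth b i.
Proof.
move=> bb v; rewrite {1}(coord_basis bb (memvf v)).
by apply: eq_bigr => i _; rewrite (tnth_nth 0).
Qed.

Lemma coord_lincomb b : basis_of {:V} b ->
  forall (k : 'I_n -> F) i, coord b i (\sum_j k j *: tnth b j) = k i.
Proof.
move=> bb k i; rewrite -(coord_sum_free k i (basis_free bb)).
by congr (coord _ _ _); apply: eq_bigr => j _; rewrite (tnth_nth 0).
Qed.

Lemma lfun_basis_eq b f g : basis_of {:V} b ->
  (forall i, f (tnth b i) = g (tnth b i)) -> f = g.
Proof.
move=> bb fg; apply/lfunP => v; rewrite (coord_expand bb v) !linear_sum.
by apply: eq_bigr => i _; rewrite !linearZ /= fg.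
Qed.

Lemma basis_size b : basis_of {:V} b -> n = \dim {:V}.
Proof. by move=> bb; rewrite (size_basis bb). Qed.

Lemma lfun_mx_apply b f : basis_of {:V} b ->
  forall j, f (tnth b j) = \sum_i lfun_mx b f i j *: tnth b i.
Proof.
move=> bb j; rewrite {1}(coord_expand bb (f _)).
by apply: eq_bigr => i _; rewrite mxE.
Qed.

Lemma lfun_mx_comp b f g : basis_of {:V} b ->
  lfun_mx b (f \o g)%VF = lfun_mx b f *m lfun_mx b g.
Proof.
move=> bb; apply/matrixP => i j; rewrite !mxE comp_lfunE.
rewrite (lfun_mx_apply g bb) !linear_sum; apply: eq_bigr => k _.
by rewrite !linearZ /= mulrC !mxE.
Qed.

Lemma lfun_mx_id b : basis_of {:V} b -> lfun_mx b \1%VF = 1%:M.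
Proof.
by move=> bb; apply/matrixP => i j; rewrite !mxE id_lfunE coord_tnth.
Qed.

Lemma lfun_mx_subZ b f (t : F) : basis_of {:V} b ->
  lfun_mx b (f - t *: \1%VF) = lfun_mx b f - t%:M.
Proof.
move=> bb; apply/matrixP => i j; rewrite !mxE add_lfunE opp_lfunE scale_lfunE.
by rewrite id_lfunE linearB linearZ /= coord_tnth // mulr_natr.
Qed.

End Bases.

Section Trace.
Variables (F : fieldType) (V : vectType F).
Implicit Types (f g E : 'End(V)).

(** The lengths n and m agree only propositionally, so the change of basis is typed as a rectangular
    matrix. *)
Lemma lfun_mx_change n m (b : n.-tuple V) (b' : m.-tuple V) f :
  basis_of {:V} b -> basis_of {:V} b' ->
  lfun_mx b' f *m (\matrix_(i, j) coord b' i (tnth b j))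
  = (\matrix_(i, j) coord b' i (tnth b j)) *m lfun_mx b f.
Proof.
move=> bb bb'; apply/matrixP => i j; rewrite !mxE.
transitivity (coord b' i (f (tnth b j))).
  rewrite (coord_expand bb' (tnth b j)) !linear_sum; apply: eq_bigr => k _.
  by rewrite !linearZ /= !mxE mulrC.
rewrite (lfun_mx_apply f bb) linear_sum; apply: eq_bigr => k _.
by rewrite linearZ /= !mxE mulrC.
Qed.

Lemma change_basis_inv n m (b : n.-tuple V) (b' : m.-tuple V) :
  basis_of {:V} b -> basis_of {:V} b' ->
  (\matrix_(i, j) coord b i (tnth b' j)) *m (\matrix_(i,
    j) coord b' i (tnth b j))
  = 1%:M.
Proof.
move=> bb bb'; apply/matrixP => i j; rewrite !mxE -(coord_tnth bb).
rewrite (coord_expand bb' (tnth b j)) linear_sum; apply: eq_bigr => k _.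
by rewrite linearZ /= !mxE mulrC.
Qed.

Lemma lfun_trace_basis n (b : n.-tuple V) f :
  basis_of {:V} b -> lfun_trace f = \tr (lfun_mx b f).
Proof.
move=> bb; have bv := vbasisP {:V}.
rewrite -[lfun_mx b f]mul1mx -(change_basis_inv bb bv) -mulmxA.
by rewrite mxtrace_mulC -(lfun_mx_change f bb bv) -mulmxA
  (change_basis_inv bv bb) mulmx1.
Qed.

End Trace.

Section Eigen.
Variables (F : fieldType) (V : vectType F).
Implicit Types (f g E : 'End(V)).

Lemma leigenspaceP f t v : v \in passmx.leigenspace f t <-> f v = t *: v.
Proof.
rewrite memv_ker add_lfunE opp_lfunE scale_lfunE id_lfunE subr_eq0.
by split => /eqP.
Qed.

Lemma leigenvalueP f t :
  passmx.leigenvalue f t <-> exists2 v, v != 0 & f v = t *: v.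
Proof.
split=> [nz|[v v0 fv]].
  exists (vpick (passmx.leigenspace f t)); first by rewrite vpick0.
  exact/leigenspaceP/memv_pick.
apply: contraNneq v0 => E0; rewrite -memv0 -E0; exact/leigenspaceP.
Qed.

Lemma associated_eigenvalueE f t E :
  primitive_idempotent f t E -> associated_eigenvalue f E = t.
Proof.
move=> pE; rewrite /associated_eigenvalue; apply: xget_unique => //= s pE'.
apply/eqP/negPn/negP => st; case: pE pE' => _ _ E0 [ls E1 _].
have /leigenvalueP[v v0 fv] := ls.
have vs : v \in passmx.leigenspace f s by apply/leigenspaceP.
by move: v0; rewrite -(E1 v vs) (E0 s) ?eqxx.
Qed.

Lemma standard_eigenbasis n f g (E : 'I_n -> 'End(V)) :
  standard_ordering f g E ->
  exists (b : n.-tuple V) (t : 'I_n -> F),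
    [/\ leonard_basis g f b, injective t,
        forall i, f (tnth b i) = t i *: tnth b i,
        forall i, associated_eigenvalue f (E i) = t i
      & forall i j, E i (tnth b j) = tnth b j *+ (i == j)].
Proof.
move=> [[injE EP] std].
have /choice[t tP] : forall i, exists t, primitive_idempotent f t (E i).
  by move=> i; apply/(EP (E i)); exists i.
have /choice[v vP] : forall i, exists v : V, v != 0 /\ f v = t i *: v.
  move=> i; have [/leigenvalueP[v v0 fv] _ _] := tP i.
  by exists v.
have Ev i : E i (v i) = v i.
  have [_ E1 _] := tP i; apply: E1; apply/leigenspaceP.
  by case: (vP i).
pose b := [tuple v i | i < n].
have bE i : tnth b i = v i by rewrite tnth_mktuple.
have lb : leonard_basis g f b.
  apply: std => i; rewrite bE; split; first by case: (vP i).
  by rewrite -Ev memv_img ?memvf.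
have bb : basis_of {:V} b by case: lb.
have Eij i j : E i (v j) = v j *+ (t i == t j).
  have [_ E1 E0] := tP i; have [v0 fv] := vP j.
  have [tij|tij] := eqVneq (t i) (t j).
    by apply: E1; apply/leigenspaceP; rewrite tij.
  by apply: (E0 (t j)); [apply/leigenvalueP;
    exists (v j)|rewrite eq_sym|apply/leigenspaceP].
(* On the basis an idempotent is determined by its eigenvalue, so injectivity passes from [E] to
   [t]. *)
have injt : injective t.
  move=> i j tij; apply: injE; apply: (lfun_basis_eq bb) => k.
  by rewrite !bE !Eij tij.
exists b, t; split=> // i; first by rewrite bE; case: (vP i).
  exact: associated_eigenvalueE.
by move=> j; rewrite !bE Eij (inj_eq injt).
Qed.

Lemma lfun_trace_comp_idempotent n (b : n.-tuple V) f E i :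
  basis_of {:V} b -> (forall j, E (tnth b j) = tnth b j *+ (i == j)) ->
  lfun_trace (f \o E)%VF = lfun_mx b f i i /\
  lfun_trace (E \o f)%VF = lfun_mx b f i i.
Proof.
move=> bb Eb; have EE : lfun_mx b E = delta_mx i i.
  apply/matrixP => k l; rewrite !mxE Eb.
  rewrite [l == i]eq_sym; case: eqP => [<-|il];
    first by rewrite coord_tnth // andbT.
  by rewrite linear0 andbF.
rewrite !(lfun_trace_basis _ bb) !lfun_mx_comp // EE.
rewrite mxtrace_mulC; split; rewrite /mxtrace (bigD1 i) //= big1 ?addr0.
- rewrite mxE (bigD1 i) //= big1 => [|k /negPf ki];
  rewrite mxE ?eqxx ?ki ?andbF ?mul0r //.
  by rewrite mul1r addr0.
- move=> j /negPf ji; rewrite mxE big1 // => k _; by rewrite mxE ji mul0r.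
- rewrite mxE (bigD1 i) //= big1 => [|k /negPf ki];
  rewrite mxE ?eqxx ?ki ?andbF ?mul0r //.
  by rewrite mul1r addr0.
- move=> j /negPf ji; rewrite mxE big1 // => k _; by rewrite mxE ji mul0r.
Qed.

End Eigen.

Section SystemData.
Variables (F : closedFieldType) (d : nat) (Phi : leonard_system F d).

Lemma leonard_system_data : exists M C P : 'M[F]_d.+1,
  [/\ leonard_data (ls_theta Phi) (ls_thetas Phi) M C P,
      inj_upto d (ls_theta Phi), inj_upto d (ls_thetas Phi),
      forall i : 'I_d.+1, ls_a Phi i = M i i /\ ls_as Phi i = C i i
    & forall t k, split_trace Phi t k
        = (\prod_(0 <= h < k) (M - (t h)%:M)) ord0 ord0].
Proof.
have [b [t [[bb irrC _] injt fb tE Eb]]] := standard_eigenbasis (ls_standard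
  Phi).
have [b' [t' [[bb' irrM _] injt' fb' tE' Eb']]] :=
  standard_eigenbasis (ls_dual_standard Phi).
have thE i : ls_theta Phi i = t (inord i) by rewrite /ls_theta tE.
have thsE i : ls_thetas Phi i = t' (inord i) by rewrite /ls_thetas tE'.
have inj (s : 'I_d.+1 -> F) : injective s -> inj_upto d (fun i => s (inord i)).
  by move=> injs i j id jd /injs /(congr1 (@nat_of_ord _)); rewrite !inordK.
pose P : 'M_d.+1 := \matrix_(i, j) coord b' i (tnth b j).
have Pu : P \in unitmx by case/mulmx1_unit: (change_basis_inv bb bb').
have diagE (c : d.+1.-tuple Phi) (s : 'I_d.+1 -> F) (f : 'End(Phi)) : basis_of
  {:Phi} c ->
    (forall i, f (tnth c i) = s i *: tnth c i) ->
    lfun_mx c f = diag_seq d (fun i => s (inord i)).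
  move=> cc fc; apply/matrixP => i j; rewrite !mxE fc linearZ /= coord_tnth //.
  by rewrite inord_val; case: eqP => [->|]; rewrite ?mulr1 ?mulr0.
have -> : ls_theta Phi = fun i => t (inord i) by apply/funext.
have -> : ls_thetas Phi = fun i => t' (inord i) by apply/funext.
exists (lfun_mx b' (ls_A Phi)), (lfun_mx b (ls_As Phi)), P.
split; [|exact: inj|exact: inj| |].
- split=> //; first by rewrite -(diagE _ _ _ bb fb) lfun_mx_change.
  by rewrite -(diagE _ _ _ bb' fb') lfun_mx_change.
- move=> i; rewrite /ls_a /ls_as !inord_val.
  by split; apply: (lfun_trace_comp_idempotent _ _ _).1.
- move=> s k; rewrite /split_trace (lfun_trace_comp_idempotent _ bb' (Eb'
  ord0)).2.
  congr (fun_of_matrix _ _ _).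
  rewrite (big_morph _ (fun f g => lfun_mx_comp f g bb') (lfun_mx_id bb')).
  by apply: eq_bigr => h _; rewrite lfun_mx_subZ.
Qed.

End SystemData.

(** * Leonard systems from matrices *)

Section BasisProjection.
Variables (F : fieldType) (V : vectType F) (n : nat).
Variable b : n.-tuple V.

Definition basis_proj_fun i (v : V) : V := coord b i v *: tnth b i.

Fact basis_proj_linear i : linear (basis_proj_fun i).
Proof.
by move=> a u v; rewrite /basis_proj_fun linearP scalerDl scalerA.
Qed.

HB.instance Definition _ i :=
  GRing.isLinear.Build F V V _ (basis_proj_fun i) (basis_proj_linear i).

Definition basis_proj i : 'End(V) := linfun (basis_proj_fun i).

Lemma basis_projE i v : basis_proj i v = coord b i v *: tnth b i.
Proof. exact: lfunE. Qed.

Hypothesis bb : basis_of {:V} b.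

Lemma basis_proj_tnth i j : basis_proj i (tnth b j) = tnth b j *+ (i == j).
Proof.
rewrite basis_projE coord_tnth //.
by case: eqP => [->|]; rewrite ?scale1r ?scale0r.
Qed.

Lemma tnth_basis_neq0 i : tnth b i != 0.
Proof. by apply: (basis_not0 bb); apply: mem_tnth. Qed.

Lemma scaled_basis (v : n.-tuple V) (k : 'I_n -> F) :
  (forall i, k i != 0) -> (forall i, tnth v i = k i *: tnth b i) ->
  basis_of {:V} v /\ (forall i u, coord v i u = (k i)^-1 * coord b i u).
Proof.
move=> k0 vE; have bv : basis_of {:V} v.
  rewrite basisEdim size_tuple {2}(basis_size bb) leqnn andbT.
  rewrite -(span_basis bb); apply/span_subvP => _ /tnthP[i ->].
  rewrite -[tnth b i]scale1r -(mulVf (k0 i)) -scalerA -vE memvZ //.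
  by rewrite memv_span // mem_tnth.
split=> // i u; rewrite -(coord_lincomb bv (fun i => (k i)^-1 * coord b i u)).
congr (coord _ _ _); rewrite {1}(coord_expand bb u); apply: eq_bigr => j _.
by rewrite vE scalerA mulrAC mulVf // mul1r.
Qed.

Lemma standard_basis_proj (f g : 'End(V)) (t : 'I_n -> F) :
  injective t -> (forall i, f (tnth b i) = t i *: tnth b i) ->
  irreducible_tridiagonal (lfun_mx b g) ->
  [/\ standard_ordering f g basis_proj, leonard_basis g f b
    & forall i, associated_eigenvalue f (basis_proj i) = t i].
Proof.
move=> injt fb irr.
have coordf v i : coord b i (f v) = t i * coord b i v.
  rewrite {1}(coord_expand bb v) linear_sum.
  rewrite -(coord_lincomb bb (fun i => t i * coord b i v)).
  congr (coord _ _ _); apply: eq_bigr => j _.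
  by rewrite linearZ /= fb scalerA mulrC.
have eigen s v i : f v = s *: v -> t i != s -> coord b i v = 0.
  move=> fv ts; have := coordf v i; rewrite fv linearZ /= => /eqP.
  rewrite -subr_eq0 -mulrBl mulf_eq0 subr_eq0 eq_sym (negPf ts) /=.
  by move/eqP.
have pE i : primitive_idempotent f (t i) (basis_proj i).
  split=> [|v /leigenspaceP fv|s v _ si /leigenspaceP fv].
  - by apply/leigenvalueP; exists (tnth b i); rewrite ?tnth_basis_neq0.
  - rewrite basis_projE {2}(coord_expand bb v) (bigD1 i) //= big1 ?addr0 // =>
    j ji.
    by rewrite (eigen _ _ _ fv) ?scale0r // (inj_eq injt).
  - by rewrite basis_projE (eigen _ _ _ fv) ?scale0r // eq_sym.
have irrE (v : n.-tuple V) (k : 'I_n -> F) : (forall i, k i != 0) ->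
    (forall i, tnth v i = k i *: tnth b i) -> leonard_basis g f v.
  move=> k0 vE; have [bv cv] := scaled_basis k0 vE.
  have entry h i j : lfun_mx v h i j = (k i)^-1 * k j * lfun_mx b h i j.
    by rewrite !mxE cv vE !linearZ /= mulrA.
  have [tri nz] := irr; split=> //.
    split=> i j; rewrite entry.
      by move=> nz0; apply: tri; apply: contraNneq nz0 => ->; rewrite mulr0.
    by move/nz => nz0; rewrite !mulf_neq0 ?invr_eq0.
  apply/is_diag_mxP => i j ij; rewrite entry mxE fb linearZ /= coord_tnth //.
  by rewrite -val_eqE (negPf ij) !mulr0.
split=> [||i]; last exact: associated_eigenvalueE.
- split; last first.
    move=> v vb; have /choice[k kP] : forall i, exists k,
      k != 0 /\ tnth v i = k *: tnth b i.
      move=> i; have [v0 /memv_imgP[u _ vE]] := vb i.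
      exists (coord b i u); rewrite -basis_projE vE; split=> //.
      by apply: contraNneq v0 => c0; rewrite vE basis_projE c0 scale0r.
    by apply: (irrE v k) => i; case: (kP i).
  split=> [i j ij|X].
    apply/eqP; have := tnth_basis_neq0 i; apply: contraNT => nij.
    by rewrite -[tnth b i]mulr1n -[1%N]/(nat_of_bool true) -(eqxx i)
      -basis_proj_tnth ij basis_proj_tnth (eq_sym j) (negPf nij).
  split=> [[s [/leigenvalueP[v v0 fv] X1 X0]]|[i <-]]; last by exists (t i).
  have /existsP[i ti] : [exists i, t i == s].
    apply: contraNT v0 => /existsPn ts.
    by rewrite (coord_expand bb v) big1 // => i _;
      rewrite (eigen _ _ _ fv) ?scale0r.
  exists i; apply: (lfun_basis_eq bb) => j; rewrite basis_proj_tnth.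
  move/eqP: ti => ti; have [ij|ij] := eqVneq i j.
    by rewrite X1 //; apply/leigenspaceP; rewrite -ti ij fb.
  rewrite (X0 (t j)) //; last exact/leigenspaceP.
    by apply/leigenvalueP; exists (tnth b j); rewrite ?tnth_basis_neq0.
  by rewrite -ti (inj_eq injt) eq_sym.
- by apply: (irrE b (fun=> 1)) => i; rewrite ?oner_neq0 ?scale1r.
Qed.

End BasisProjection.

Section Realization.
Variables (F : closedFieldType) (d : nat) (th ths : nat -> F).
Variables M C P : 'M[F]_d.+1.
Hypothesis data : leonard_data th ths M C P.
Hypotheses (inj : inj_upto d th) (injs : inj_upto d ths).

Let V : vectType F := 'cV[F]_d.+1.

Lemma unit_col_basis (Q : 'M[F]_d.+1) : Q \in unitmx ->
  basis_of {:V} [tuple (col i Q : V) | i < d.+1].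
Proof.
move=> Qu; set b := [tuple _ | _ < _].
have dimV : \dim {:V} = d.+1 by rewrite dimvf /dim /= muln1.
rewrite basisEdim size_tuple dimV leqnn andbT.
apply/subvP => v _; have -> : v = \sum_i (invmx Q *m v) i 0 *: tnth b i.
  rewrite -[LHS](mulKVmx Qu); apply/matrixP => i j; rewrite !mxE summxE.
  by apply: eq_bigr => k _; rewrite tnth_mktuple !mxE ord1 mulrC.
by apply: memv_suml => i _; rewrite memvZ // memv_span // mem_tnth.
Qed.

(** [leonard_pair] asks for tuples of length [\dim], which equals [d.+1] only propositionally. *)
Lemma leonard_basis_cast (W : vectType F) n m (f g : 'End(W)) (b : n.-tuple W) :
  n = m -> leonard_basis f g b -> exists b' : m.-tuple W, leonard_basis f g b'.
Proof. by move=> <-; exists b. Qed.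

Lemma leonard_system_of_data : exists Phi : leonard_system F d,
  [/\ forall i, (i <= d)%N -> ls_theta Phi i = th i,
      forall i, (i <= d)%N -> ls_thetas Phi i = ths i
    & ls_a Phi 0 = M ord0 ord0].
Proof.
have [Pu irrM irrC MP DP] := data.
pose f : 'End(V) := linfun (mulmx M);
  pose g : 'End(V) := linfun (mulmx (diag_seq d ths)).
pose b := [tuple (col i P : V) | i < d.+1].
pose b' := [tuple (col i 1%:M : V) | i < d.+1].
have bb : basis_of {:V} b by apply: unit_col_basis.
have bb' : basis_of {:V} b' by apply: unit_col_basis; rewrite unitmx1.
have colM (X Q : 'M[F]_d.+1) i : X *m col i Q = col i (X *m Q).
  by rewrite !colE mulmxA.
have lfun_mx_col (Q X Y : 'M[F]_d.+1) (h : 'End(V)) (c : d.+1.-tuple V) :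
    basis_of {:V} c -> (forall i, tnth c i = col i Q) -> (forall v,
      h v = X *m v) ->
    X *m Q = Q *m Y -> lfun_mx c h = Y.
  move=> cb cE hE XQ; apply/matrixP => i j.
  rewrite mxE hE -(coord_lincomb cb (Y^~ j)); congr (coord _ _ _).
  rewrite cE colM XQ; apply/matrixP => k l; rewrite summxE !mxE.
  by apply: eq_bigr => m _; rewrite cE !mxE mulrC.
have eigE (Q X : 'M[F]_d.+1) s (h : 'End(V)) (c : d.+1.-tuple V) :
    (forall i, tnth c i = col i Q) -> (forall v, h v = X *m v) ->
    X *m Q = Q *m diag_seq d s -> forall i, h (tnth c i) = s i *: tnth c i.
  move=> cE hE XQ i; rewrite hE cE colM XQ; apply/matrixP => k l.
  by rewrite mxE mul_seq_diag mulrC !mxE.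
have fE v : f v = M *m v by rewrite lfunE.
have gE v : g v = diag_seq d ths *m v by rewrite lfunE.
have bE i : tnth b i = col i P by rewrite tnth_mktuple.
have bE' i : tnth b' i = col i 1%:M by rewrite tnth_mktuple.
have gC : lfun_mx b g = C by apply: (lfun_mx_col P (diag_seq d ths)).
have fM : lfun_mx b' f = M by apply: (lfun_mx_col 1%:M M);
  rewrite ?mulmx1 ?mul1mx.
have injI (s : nat -> F) : inj_upto d s -> injective (fun i : 'I_d.+1 => s i).
  by move=> injs0 i j /injs0 E; apply/val_inj/E; rewrite /= -ltnS.
have [std lb tE] := standard_basis_proj bb (injI _ inj) (eigE _ _ _ _ _ bE fE
  MP)
  (eq_ind_r (@irreducible_tridiagonal F d.+1) irrC gC).
have eigg := eigE 1%:M (diag_seq d ths) ths g b' bE' gE (etrans (mulmx1 _)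
  (esym (mul1mx _))).
have [std' lb' tE'] := standard_basis_proj bb' (injI _ injs) eigg
  (eq_ind_r (@irreducible_tridiagonal F d.+1) irrM fM).
have dimV : \dim {:V} = d.+1 by rewrite -(basis_size bb).
have pair : leonard_pair f g.
  by split; [apply: leonard_basis_cast lb' | apply: leonard_basis_cast lb].
exists (LeonardSystem dimV pair std std'); split.
- by move=> i id; rewrite /ls_theta /= tE inordK.
- by move=> i id; rewrite /ls_thetas /= tE' inordK.
- rewrite /ls_a /=; have -> : ord0 = inord 0 :> 'I_d.+1 by apply: val_inj;
  rewrite /= inordK.
  have [-> _] := lfun_trace_comp_idempotent f bb' (basis_proj_tnth bb' (inord
    0)).
  by rewrite fM.
Qed.

End Realization.

(** * Relations satisfied by every Leonard system *)

Section Band.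
Variables (F : fieldType) (d : nat).
Implicit Types (M X Y : 'M[F]_d.+1).

(** An end index with its neighbour. A relation proved once for such pairs yields all four
    combinations of ends of A and A*. *)
Definition endpoint (j j' : 'I_d.+1) : Prop :=
  (j = 0 :> nat /\ j' = 1 :> nat) \/ (j = d :> nat /\ j = j'.+1 :> nat).

Lemma endpoint_neq j j' : endpoint j j' -> j != j'.
Proof. by case=> -[jE j'E]; apply/eqP => E; move: j'E; rewrite -E; lia. Qed.

Lemma sum_endpoint M (f : 'I_d.+1 -> F) j j' : irreducible_tridiagonal M ->
  endpoint j j' -> \sum_k M j k * f k = M j j * f j + M j j' * f j'.
Proof.
move=> [tri _] ej; have jj' := endpoint_neq ej.
rewrite (bigD1 j) //= (bigD1 j') 1?eq_sym //= big1 ?addr0 // => k /andP[kj kj'].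
suff -> : M j k = 0 by rewrite mul0r.
apply/eqP/negPn/negP => /tri[E|E|E].
- by rewrite E eqxx in kj.
- case/eqP: kj'; apply: val_inj => /=.
  by case: ej => -[jE j'E]; move: E j'E; rewrite ?jE; lia.
- case/eqP: kj'; apply: val_inj => /=.
  by case: ej => -[jE j'E]; move: E j'E (ltn_ord k); rewrite ?jE; lia.
Qed.

(** The superdiagonal is nonzero, so row m of the eigenvalue equation determines v_(m+1) from
    earlier entries. *)
Lemma eigenvector_start M (v : 'I_d.+1 -> F) t : irreducible_tridiagonal M ->
  (forall i, \sum_j M i j * v j = t * v i) -> v ord0 = 0 -> forall i, v i = 0.
Proof.
move=> [tri irr] Mv v0.
suff H m : forall i : 'I_d.+1, (i <= m)%N -> v i = 0 by move=> i; apply: (H i).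
elim: m => [|m IHm] i; first by rewrite leqn0 => /eqP i0; rewrite -v0; congr v;
  apply: val_inj.
rewrite leq_eqVlt => /orP[/eqP im|]; last by rewrite ltnS; apply: IHm.
have md : (m < d.+1)%N by have := ltn_ord i; lia.
have := Mv (Ordinal md); rewrite (IHm (Ordinal md)) // mulr0.
rewrite (bigD1 i) //= big1 => [|j ji].
  move/eqP; rewrite addr0 mulf_eq0 => /orP[|/eqP //].
  by rewrite (negPf (irr (Ordinal md) i _)) //; right.
have [jm|mj] := leqP j m; first by rewrite IHm ?mulr0.
have [->|] := eqVneq (M (Ordinal md) j) 0; first by rewrite mul0r.
move/tri => [E|/= E|/= E].
- by rewrite -E ltnn in mj.
- by lia.
- by case/eqP: ji; apply: val_inj; rewrite /= E.
Qed.

Lemma irreducible_tridiagonal_rev M : irreducible_tridiagonal M ->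
  irreducible_tridiagonal (\matrix_(i, j) M (rev_ord i) (rev_ord j)).
Proof.
move=> [tri irr]; split=> i j; rewrite mxE.
  have := ltn_ord i; have := ltn_ord j => jd id.
  case/tri => [/rev_ord_inj ->|/= E|/= E]; first by constructor 1.
    by constructor 3; lia.
  by constructor 2; lia.
have := ltn_ord i; have := ltn_ord j => jd id.
by move=> ij; apply: irr => /=; lia.
Qed.

Lemma eigenvector_endpoint M (v : 'I_d.+1 -> F) t j j' :
  irreducible_tridiagonal M ->
  (forall i, \sum_k M i k * v k = t * v i) -> endpoint j j' ->
  v j = 0 -> forall i, v i = 0.
Proof.
move=> irr Mv [[j0 _]|[jd _]] vj i.
  by apply: (eigenvector_start irr Mv); rewrite -vj; congr v; apply: val_inj.
rewrite -(rev_ordK i); move: (rev_ord i).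
apply: (@eigenvector_start _ (v \o @rev_ord _) t (irreducible_tridiagonal_rev
  irr)).
  move=> k; rewrite /= -Mv [RHS](reindex_inj rev_ord_inj).
  by apply: eq_bigr => l _; rewrite mxE.
by rewrite /= -vj; congr v; apply: val_inj; rewrite /= jd subn1.
Qed.

Definition band k X := forall i j : 'I_d.+1, (j + k < i)%N -> X i j = 0.

Lemma band_mul k l X Y : band k X -> band l Y -> band (k + l)%N (X *m Y).
Proof.
move=> bX bY i j ij; rewrite mxE big1 // => m _.
have [mi|im] := ltnP (m + k) i; first by rewrite bX ?mul0r.
by rewrite bY ?mulr0 //; lia.
Qed.

Lemma band_mul_corner k l X Y (i m j : 'I_d.+1) : band k X -> band l Y ->
  i = (m + k)%N :> nat -> m = (j + l)%N :> nat ->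
  (X *m Y) i j = X i m * Y m j.
Proof.
move=> bX bY im mj; rewrite mxE (bigD1 m) //= big1 ?addr0 // => h.
rewrite -val_eqE /= neq_ltn => /orP[hm|mh]; first by rewrite bX ?mul0r //; lia.
by rewrite bY ?mulr0 //; lia.
Qed.

Lemma band_tridiagonal M : tridiagonal M -> band 1 M.
Proof.
by move=> tri i j ij; apply/eqP/negPn/negP => /tri[E|E|E]; move: ij; rewrite E;
  lia.
Qed.

Lemma band_sub_scalar M s : tridiagonal M -> band 1 (M - s%:M).
Proof.
move=> /band_tridiagonal bM i j ij; rewrite !mxE bM // sub0r.
by case: eqP ij => [->|]; rewrite ?oppr0 //; lia.
Qed.

Lemma band_diag s : band 0 (diag_seq d s).
Proof.
by move=> i j ij; rewrite !mxE; case: eqP ij => [->|//]; lia.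
Qed.

Lemma band1 : band 0 (1%:M : 'M[F]_d.+1).
Proof.
by move=> i j ij; rewrite !mxE; case: eqP ij => [->|//]; lia.
Qed.

Lemma band_prod M (s : nat -> F) k : tridiagonal M ->
  band k (\prod_(0 <= h < k) (M - (s h)%:M)).
Proof.
move=> tri; elim: k => [|k IHk]; first by rewrite big_geq //; apply: band1.
by rewrite big_nat_recr //= -addn1; apply: band_mul IHk (band_sub_scalar _ tri).
Qed.

End Band.

Section Necessary.
Variables (F : fieldType) (d : nat) (th ths : nat -> F).
Variables M C P : 'M[F]_d.+1.
Hypothesis data : leonard_data th ths M C P.
Hypotheses (inj : inj_upto d th) (injs : inj_upto d ths).
Local Notation Q := (invmx P).

Lemma data_unit : P \in unitmx. Proof. by case: data. Qed.
Lemma data_irrM : irreducible_tridiagonal M. Proof. by case: data. Qed.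
Lemma data_irrC : irreducible_tridiagonal C. Proof. by case: data. Qed.
Let Pu := data_unit. Let irrM := data_irrM. Let irrC := data_irrC.

Lemma data_mulMP i j : \sum_k M i k * P k j = th j * P i j.
Proof.
case: data => _ _ _ /matrixP/(_ i j); rewrite mul_seq_diag mxE => -> _.
exact: mulrC.
Qed.

Lemma data_mulPC i j : \sum_k P i k * C k j = ths i * P i j.
Proof. by case: data => _ _ _ _ /matrixP/(_ i j);
  rewrite mul_diag_seq mxE => ->. Qed.

Lemma data_mulQM i j : \sum_k Q i k * M k j = th i * Q i j.
Proof.
have QM : Q *m M = diag_seq d th *m Q.
  case: data => _ _ _ MP _.
  by rewrite -[LHS](mulmxK Pu) -[Q *m M *m P]mulmxA MP mulKmx.
by have /matrixP/(_ i j) := QM; rewrite mul_diag_seq mxE => ->.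
Qed.

Lemma data_mulCQ i j : \sum_k C i k * Q k j = ths j * Q i j.
Proof.
have CQ : C *m Q = Q *m diag_seq d ths.
  case: data => _ _ _ _ PC.
  by rewrite -[RHS](mulmxK Pu) -(mulmxA Q) PC mulKmx.
by have /matrixP/(_ i j) := CQ; rewrite mul_seq_diag mxE mulrC => ->.
Qed.

Lemma unit_row_neq0 (X : 'M[F]_d.+1) i : X \in unitmx -> ~ (forall j,
  X i j = 0).
Proof.
move=> Xu X0; have /matrixP/(_ i i) := mulmxV Xu.
rewrite !mxE eqxx big1 => [/eqP|k _]; last by rewrite X0 mul0r.
by rewrite eq_sym oner_eq0.
Qed.

Lemma unit_col_neq0 (X : 'M[F]_d.+1) j : X \in unitmx -> ~ (forall i,
  X i j = 0).
Proof.
move=> Xu X0; apply: (@unit_row_neq0 X^T j); first by rewrite unitmx_tr.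
by move=> i; rewrite mxE.
Qed.

Let Qu : Q \in unitmx. Proof. by rewrite unitmx_inv. Qed.

Lemma P_endpoint_row i i' j : endpoint i i' -> P i j != 0.
Proof.
move=> ei; apply/eqP => P0; apply: (unit_col_neq0 (j := j) Pu).
exact: (eigenvector_endpoint irrM (v := P^~ j) (fun i => data_mulMP i j) ei P0).
Qed.

Lemma Q_endpoint_row i i' j : endpoint i i' -> Q i j != 0.
Proof.
move=> ei; apply/eqP => Q0; apply: (unit_col_neq0 (j := j) Qu).
exact: (eigenvector_endpoint irrC (v := Q^~ j) (fun i => data_mulCQ i j) ei Q0).
Qed.

Lemma Q_endpoint_col i j j' : endpoint j j' -> Q i j != 0.
Proof.
move=> ej; apply/eqP => Q0; apply: (unit_row_neq0 (i := i) Qu).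
apply: (eigenvector_endpoint (irreducible_tridiagonal_tr irrM) (t := th i)
  _ ej Q0) => k.
rewrite -data_mulQM; by apply: eq_bigr => l _; rewrite mxE mulrC.
Qed.

(* Both sides are read off from the (j, i) entry of Q A* A, computed in two ways. *)
Lemma endpoint_relation i i' j j' : endpoint i i' -> endpoint j j' ->
  (M i i - th j) * (ths i - ths i') = (C j j - ths i) * (th j - th j').
Proof.
move=> ei ej; have Q0 := Q_endpoint_col j ei.
have sumM (f : 'I_d.+1 -> F) : \sum_k f k * M k i = f i * M i i + f i' * M i' i.
  have := sum_endpoint f (irreducible_tridiagonal_tr irrM) ei; rewrite !mxE.
  rewrite ![M _ _ * _]mulrC => <-; by apply: eq_bigr => k _; rewrite mxE mulrC.
have h1 := data_mulQM j i; rewrite sumM in h1.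
have h2 := data_mulCQ j i; rewrite (sum_endpoint (Q^~ i) irrC ej) in h2.
have h3 : \sum_k (\sum_l C j l * Q l k) * M k i = \sum_l C j l * (th l * Q l i).
  under eq_bigr => k _ do rewrite mulr_suml.
  rewrite exchange_big /=; apply: eq_bigr => l _.
  by rewrite -data_mulQM mulr_sumr; apply: eq_bigr => k _; rewrite mulrA.
rewrite (eq_bigr (fun k : 'I_d.+1 => ths k * Q j k * M k i)) in h3; last first.
  by move=> k _; rewrite data_mulCQ.
rewrite (sumM (fun k : 'I_d.+1 => ths k * Q j k)) (sum_endpoint _ irrC ej) in
  h3.
apply: (mulIf Q0).
by apply: (lincomb3 h1 h2 h3 (- ths i') (th j') 1); ring.
Qed.

(** Equality would reduce the (j, i) entry of Q M to Q_ji' M_i'i = 0, with both factors nonzero. For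
    a Leonard system this is the nonvanishing of the split scalars of index 1 and d. *)
Lemma endpoint_neq_eigenvalue (i i' j j' : 'I_d.+1) : endpoint i i' -> endpoint
  j j' ->
  M i i != th j.
Proof.
move=> ei ej; apply/eqP => Mij.
have := data_mulQM j i.
have -> : \sum_k Q j k * M k i = Q j i * M i i + Q j i' * M i' i.
  have := sum_endpoint (Q j) (irreducible_tridiagonal_tr irrM) ei; rewrite !mxE.
  rewrite ![M _ _ * _]mulrC => <-; by apply: eq_bigr => k _; rewrite mxE mulrC.
rewrite Mij mulrC => /eqP; rewrite -subr_eq0 addrAC subrr add0r mulf_eq0.
rewrite (negPf (Q_endpoint_row i' ej)) /=; apply/negP.
case: irrM => _; apply; case: ei => -[E E']; [left | right] => //; lia.
Qed.

Lemma prod_sub_data (s : nat -> F) k i j :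
  (\prod_(0 <= h < k) (M - (s h)%:M)) i j
  = \sum_l P i l * (\prod_(0 <= h < k) (th l - s h)) * Q l j.
Proof.
suff -> : \prod_(0 <= h < k) (M - (s h)%:M)
          = P *m diag_seq d (fun l => \prod_(0 <= h < k) (th l - s h)) *m Q.
  by rewrite mxE; apply: eq_bigr => l _; rewrite mul_seq_diag.
elim: k => [|k IHk].
  rewrite big_geq // -[LHS](mulmxV Pu); congr (_ *m _).
  by apply/matrixP => u l; rewrite mul_seq_diag big_geq // mulr1.
rewrite big_nat_recr //= IHk -[LHS](mulmxK Pu); congr (_ *m _).
rewrite -[LHS]mulmxA; have -> : (M - (s k)%:M) *m P = P *m diag_seq d (fun l =>
  th l - s k).
  case: data => _ _ _ MP _; rewrite mulmxBl MP mul_scalar_mx -mul_mx_scalar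
    -mulmxBr.
  congr (_ *m _); apply/matrixP => u l; rewrite !mxE.
  by case: eqP => _; rewrite ?mulr0n ?mulr1n ?subr0.
rewrite mulmxA mulmxKV //; apply/matrixP => u l.
by rewrite !mul_seq_diag big_nat_recr //= mulrA.
Qed.

(** After d - 1 factors only the eigenvectors j and j' survive, and the (d, 0) entry vanishes by
    bandwidth. With rows 0 and d of column j of P C = B P, B the diagonal form of A*, this fixes the
    ratio. The pairs (d, d - 1) and (0, 1) yield varphi_d and phi_d. *)
Lemma split_trace_ratio (s : nat -> F) j j' : (0 < d)%N -> endpoint j j' ->
  (forall k : 'I_d.+1, k != j -> k != j' -> exists2 h,
    (h < d.-1)%N & s h = th k) ->
  (forall h, (h < d.-1)%N -> s h != th j) -> s d.-1 = th j' ->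
  (ths 0 - ths d) *
  ((\prod_(0 <= h < d) (M - (s h)%:M)) ord0 ord0
   / (\prod_(0 <= h < d.-1) (M - (s h)%:M)) ord0 ord0)
  = (C j j - ths d) * (th j - th j').
Proof.
move=> d0 ej cover sj sj'.
pose w (l : 'I_d.+1) := \prod_(0 <= h < d.-1) (th l - s h) * Q l ord0.
have jj' := endpoint_neq ej.
have entry i : (\prod_(0 <= h < d.-1) (M - (s h)%:M)) i ord0 = P i j * w j + P
  i j' * w j'.
  rewrite prod_sub_data (bigD1 j) //= (bigD1 j') 1?eq_sym //=.
  rewrite [X in _ + (_ + X)]big1 ?addr0 /w ?mulrA //.
  move=> k /andP[kj kj']; have [h hd sh] := cover k kj kj'.
  rewrite (bigD1_seq h) ?mem_index_iota ?iota_uniq //= sh subrr.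
  by rewrite mul0r mulr0 mul0r.
have entryN : (\prod_(0 <= h < d) (M - (s h)%:M)) ord0 ord0
    = P ord0 j * w j * (th j - th j').
  rewrite prod_sub_data (bigD1 j) //= (bigD1 j') 1?eq_sym //=.
  rewrite [X in _ + (_ + X)]big1 ?addr0 => [|k].
    rewrite -[in index_iota _ d](prednK d0) !big_nat_recr //= sj' subrr /w;
      ring.
  move=> /andP[kj kj']; have [h hd sh] := cover k kj kj'.
  rewrite (bigD1_seq h) ?mem_index_iota ?iota_uniq //= ?sh ?subrr; last by lia.
  by rewrite mul0r mulr0 mul0r.
pose i1 : 'I_d.+1 := Ordinal (d0 : 1 < d.+1)%N.
have e0 : endpoint (ord0 : 'I_d.+1) i1 by left.
have dp : (d.-1 < d.+1)%N by rewrite prednK // ltnW.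
have ed : endpoint (ord_max : 'I_d.+1) (Ordinal dp) by right; rewrite /= prednK.
have corner : P ord_max j * w j + P ord_max j' * w j' = 0.
  by rewrite -entry (band_prod s irrM.1) //= add0n prednK.
have colC i : P i j * C j j + P i j' * C j' j = ths i * P i j.
  rewrite -data_mulPC.
  have := sum_endpoint (P i) (irreducible_tridiagonal_tr irrC) ej; rewrite !mxE.
  rewrite ![C _ _ * _]mulrC => <-; by apply: eq_bigr => k _; rewrite mxE mulrC.
have Pd := P_endpoint_row j ed; have P0 := P_endpoint_row j e0.
have wj : w j != 0.
  rewrite mulf_neq0 ?(Q_endpoint_row _ ej) // big_nat.
  elim/big_ind: _ => [||h hd]; [exact: oner_neq0 | exact: mulf_neq0 |].
  by rewrite subr_eq0 eq_sym sj.
clearbody w; have th0 : ths 0 - ths d != 0.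
  by rewrite subr_eq0; apply/eqP => /injs -/(_ isT (leqnn d)) E; have := d0;
    rewrite -E.
have wC : w j * C j' j = (C j j - ths d) * w j'.
  apply: (mulfI Pd).
  by apply: (lincomb2 corner (colC ord_max) (C j' j) (- w j')) => /=; ring.
have key : (ths 0 - ths d) * (P ord0 j * w j)
    = (C j j - ths d) * (P ord0 j * w j + P ord0 j' * w j').
  by apply: (lincomb2 wC (colC ord0) (P ord0 j') (- w j)) => /=; ring.
have den0 : P ord0 j * w j + P ord0 j' * w j' != 0.
  apply/eqP => den0; move/eqP: key; rewrite den0 mulr0.
  by rewrite !mulf_eq0 (negPf th0) (negPf P0) (negPf wj).
by rewrite entryN entry mulrA mulrA key; field.
Qed.

End Necessary.

Lemma poly_interpolation (F : fieldType) d (th z : nat -> F) : inj_upto d th ->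
  exists2 p : {poly F}, (size p <= d.+1)%N & forall i,
    (i <= d)%N -> p.[th i] = z i.
Proof.
move=> inj; suff H m : (m <= d.+1)%N ->
    exists2 p : {poly F}, (size p <= m)%N & forall i,
      (i < m)%N -> p.[th i] = z i.
  by have [//|p ps pz] := H d.+1; exists p.
elim: m => [|m IHm] md; first by exists 0; rewrite ?size_poly0.
have [|p ps pz] := IHm; first exact: ltnW.
pose q := \prod_(h <- iota 0 m) ('X - (th h)%:P).
have qm : q.[th m] != 0.
  rewrite horner_prod prodf_seq_neq0; apply/allP => h /=.
  rewrite mem_iota hornerXsubC subr_eq0 => hm.
  by apply/eqP => /inj E; have := E md; lia.
have qs : size q = m.+1 by rewrite size_prod_XsubC size_iota.
exists (p + ((z m - p.[th m]) / q.[th m]) *: q).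
  rewrite (leq_trans (size_polyD _ _)) // geq_max (leq_trans ps) //=.
  by rewrite (leq_trans (size_scale_leq _ _)) ?qs.
move=> i; rewrite ltnS leq_eqVlt hornerD hornerZ => /orP[/eqP ->|im].
  by rewrite divfK // addrC subrK.
suff -> : q.[th i] = 0 by rewrite mulr0 addr0 pz.
rewrite horner_prod (bigD1_seq i) ?mem_iota ?iota_uniq //=.
by rewrite hornerXsubC subrr mul0r.
Qed.

(** * The common recurrence of the two eigenvalue sequences *)

Section Recurrence.
Variables (F : fieldType) (d : nat) (th ths : nat -> F).
Variables M C P : 'M[F]_d.+1.
Hypothesis data : leonard_data th ths M C P.
Hypotheses (inj : inj_upto d th) (injs : inj_upto d ths).
Local Notation B := (diag_seq d ths).

Let tri := (data_irrM data).1.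
Let Pu := data_unit data.

Lemma band_exp k : band k (M ^+ k).
Proof.
elim: k => [|k IHk]; first by rewrite expr0; apply: band1.
by rewrite exprSr -addn1; apply: band_mul IHk (band_tridiagonal tri).
Qed.

Lemma exp_corner k (i j : 'I_d.+1) : i = (j + k)%N :> nat -> (M ^+ k) i j != 0.
Proof.
elim: k i j => [|k IHk] i j ij.
  have -> : i = j by apply: val_inj; rewrite /= ij addn0.
  by rewrite expr0 mxE eqxx oner_neq0.
have jd : (j.+1 < d.+1)%N by have := ltn_ord i; lia.
rewrite exprSr -[_ * _]/(_ *m _).
rewrite (@band_mul_corner _ _ k 1 _ _ i (Ordinal jd) j) /=; try lia.
- by rewrite mulf_neq0 ?IHk /= ?ij ?addSnnS // (data_irrM data).2 //; left.
- exact: band_exp.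
- exact: band_tridiagonal.
Qed.

Lemma exp_mulP k : M ^+ k *m P = P *m diag_seq d (fun i => th i ^+ k).
Proof.
elim: k => [|k IHk].
  rewrite expr0 mul1mx; apply/matrixP => i j.
  by rewrite mul_seq_diag expr0 mulr1.
rewrite exprSr -[_ * M]/(_ *m _) -mulmxA; case: data => _ _ _ -> _.
rewrite mulmxA IHk; apply/matrixP => i j.
by rewrite !mul_seq_diag exprSr mulrA.
Qed.

Section PolyOfM.
Variable p : {poly F}.
Hypothesis sp : (size p <= d.+1)%N.

Let Z : 'M[F]_d.+1 := \sum_(k < size p) p`_k *: M ^+ k.

Lemma polyM_mulP : Z *m P = P *m diag_seq d (fun i => p.[th i]).
Proof.
rewrite mulmx_suml; apply/matrixP => i j; rewrite mul_seq_diag summxE.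
rewrite horner_coef mulr_sumr; apply: eq_bigr => k _.
by rewrite -scalemxAl exp_mulP mxE mul_seq_diag; ring.
Qed.

Lemma polyM_corner k (i j : 'I_d.+1) : (size p <= k.+1)%N ->
  i = (j + k)%N :> nat -> Z i j = p`_k * (M ^+ k) i j.
Proof.
move=> pk ij; rewrite summxE; have [kp|kp] := ltnP k (size p).
  rewrite (bigD1 (Ordinal kp)) //= mxE big1 ?addr0 // => h.
  rewrite -val_eqE /= => hk; rewrite mxE band_exp ?mulr0 //.
  by have := leq_trans (ltn_ord h) pk; rewrite ltnS leq_eqVlt (negPf hk) /= ij;
    lia.
rewrite big1 ?nth_default ?mul0r // => h _; rewrite mxE band_exp ?mulr0 //.
by have := ltn_ord h; lia.
Qed.

(** On neighbouring eigenvalues, p(A) A* - A* p(A) is thereby made to agree with A^2 A* A - A A*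
    A^2. *)
Hypothesis pth : forall i, (i < d)%N ->
  p.[th i] - p.[th i.+1] = th i * th i.+1 * (th i - th i.+1).

(* Conjugated by [P] both sides become matrices whose (i, j) entry is a multiple
   of [C i j], and [C] is tridiagonal. *)
Lemma bracket_identity :
  M *m M *m B *m M - M *m B *m (M *m M) = Z *m B - B *m Z.
Proof.
case: (data) => _ _ _ MP BP.
suff E : (M *m M *m B *m M - M *m B *m (M *m M)) *m P = (Z *m B - B *m Z) *m P.
  by rewrite -[LHS](mulmxK Pu) E mulmxK.
pose D := diag_seq d th; pose pD := diag_seq d (fun i => p.[th i]).
have -> : (Z *m B - B *m Z) *m P = P *m (pD *m C - C *m pD).
  rewrite mulmxBl -!mulmxA BP polyM_mulP (mulmxA Z) polyM_mulP (mulmxA B) BP.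
  by rewrite mulmxBr !mulmxA.
have -> : (M *m M *m B *m M - M *m B *m (M *m M)) *m P
          = P *m (D *m D *m C *m D - D *m C *m D *m D).
  rewrite mulmxBl -!mulmxA MP mulmxBr; congr (_ - _).
    by rewrite (mulmxA B) BP -!mulmxA (mulmxA M P) MP -!mulmxA (mulmxA M P) MP
      !mulmxA.
  by rewrite (mulmxA M P) MP -!mulmxA (mulmxA B P) BP -!mulmxA (mulmxA M P) MP
    !mulmxA.
congr (_ *m _); apply/matrixP => i j.
have entB (X Y : 'M[F]_d.+1) : (X - Y) i j = X i j - Y i j by rewrite !mxE.
rewrite !entB !mul_seq_diag -!mulmxA !mul_diag_seq.
have [->|Cij] := eqVneq (C i j) 0; first by ring.
have := ltn_ord i; have := ltn_ord j; rewrite !ltnS => jd id.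
case: ((data_irrC data).1 i j Cij) => [->|ij|ji]; first by ring.
  rewrite ij in id *; have h := pth id.
  by apply: (lincomb1 h (C i j)); ring.
rewrite ji in jd *; have h := pth jd.
by apply: (lincomb1 h (- C i j)); ring.
Qed.

(** The left side of the bracket identity has lower bandwidth 3, whereas in degree k > 3 the (k, 0)
    entry on the right is the nonzero p_k (M^k)_k0 (theta*_0 - theta*_k). *)
Lemma bracket_size : (size p <= 4)%N.
Proof.
rewrite leqNgt; apply/negP => sp4.
have [k sk] : exists k, size p = k.+1 by case: (size p) sp4 => // k; exists k.
rewrite sk in sp4; have kd : (k < d.+1)%N by rewrite -sk.
have := congr1 (fun X : 'M_d.+1 => X (Ordinal kd) ord0) bracket_identity.
have bM := band_tridiagonal tri; have bB := @band_diag _ d ths.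
have b1 := band_mul (band_mul (band_mul bM bM) bB) bM.
have b2 := band_mul (band_mul bM bB) (band_mul bM bM).
have entB (X Y : 'M[F]_d.+1) i j : (X - Y) i j = X i j - Y i j by rewrite !mxE.
rewrite !entB b1 ?b2 //= mul_seq_diag mul_diag_seq /= (@polyM_corner k) ?sk //=.
move/eqP; rewrite subrr eq_sym (mulrC (ths k)) -mulrBr !mulf_eq0.
have -> : p`_k = lead_coef p by rewrite lead_coefE sk.
rewrite (negPf (exp_corner _)) // lead_coef_eq0 -size_poly_eq0 sk /=.
rewrite subr_eq0 => /eqP /injs E; have := E isT kd.
by move=> k0; rewrite -k0 in sp4.
Qed.

(** The (j + 3, j) entries of the bracket identity share a product of three subdiagonal entries of
    M, which cancels. *)
Lemma bracket_corner j : (j.+3 <= d)%N ->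
  ths j.+1 - ths j.+2 = p`_3 * (ths j - ths j.+3).
Proof.
move=> jd.
have j0 : (j < d.+1)%N by lia.
have j1 : (j.+1 < d.+1)%N by lia.
have j2 : (j.+2 < d.+1)%N by lia.
have j3 : (j.+3 < d.+1)%N by lia.
have := congr1 (fun X : 'M_d.+1 => X (Ordinal j3) (Ordinal j0))
  bracket_identity.
have bM := band_tridiagonal tri; have bB := @band_diag _ d ths.
have entB (X Y : 'M[F]_d.+1) i k : (X - Y) i k = X i k - Y i k by rewrite !mxE.
rewrite !entB mul_seq_diag mul_diag_seq (@polyM_corner 3) /=;
  [|exact: bracket_size|lia].
set i3 := Ordinal j3; set i0 := Ordinal j0.
pose i1 := Ordinal j1; pose i2 := Ordinal j2.
have e2 (i k l : 'I_d.+1) : i = k.+1 :> nat -> k = l.+1 :> nat -> (M *m M) i l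
  = M i k * M k l.
  by move=> ik kl; apply: (band_mul_corner bM bM); lia.
have -> : (M *m M *m B *m M) i3 i0 = M i3 i2 * M i2 i1 * ths j.+1 * M i1 i0.
  rewrite (band_mul_corner (m := i1) (band_mul (band_mul bM bM) bB) bM) /=;
    try lia.
  by rewrite mul_seq_diag (e2 _ i2).
have -> : (M *m B *m (M *m M)) i3 i0 = M i3 i2 * ths j.+2 * (M i2 i1 * M i1 i0).
  rewrite (band_mul_corner (m := i2) (band_mul bM bB) (band_mul bM bM)) /=;
    try lia.
  by rewrite mul_seq_diag (e2 _ i1).
have -> : (M ^+ 3) i3 i0 = M i3 i2 * M i2 i1 * M i1 i0.
  rewrite exprSr -[_ * M]/(_ *m _) expr2.
  by rewrite (band_mul_corner (m := i1) (band_mul bM bM) bM) /= ?(e2 _ i2);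
    try lia.
have m3 : M i3 i2 != 0 by apply: (data_irrM data).2; left.
have m2 : M i2 i1 != 0 by apply: (data_irrM data).2; left.
have m1 : M i1 i0 != 0 by apply: (data_irrM data).2; left.
move=> h; apply: (mulfI m3); apply: (mulfI m2); apply: (mulfI m1).
by apply: (lincomb1 h 1); ring.
Qed.

(** Two divided differences of the cubic p make [pth] linear in the eigenvalues; consecutive
    instances are then subtracted. *)
Lemma bracket_eigenvalues j : (j.+3 <= d)%N ->
  th j.+1 - th j.+2 = p`_3 * (th j - th j.+3).
Proof.
move=> jd.
have pE x : p.[x] = p`_3 * x ^+ 3 + p`_2 * x ^+ 2 + p`_1 * x + p`_0.
  rewrite (horner_coef_wide _ bracket_size) !big_ord_recl big_ord0 /=.
  by rewrite /bump /= !add1n ?addn0; ring.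
pose Q x y := p`_3 * (x ^+ 2 + x * y + y ^+ 2) + p`_2 * (x + y) + p`_1 - x * y.
have Q0 i : (i < d)%N -> Q (th i) (th i.+1) = 0.
  move=> id; have n : th i - th i.+1 != 0.
    by rewrite subr_eq0; apply/eqP => /inj E; have := E (ltnW id) id; lia.
  apply: (mulfI n); have h := pth id; rewrite !pE in h.
  by apply: (lincomb1 h 1); rewrite /Q; ring.
pose L i := p`_3 * (th i + th i.+1 + th i.+2) + p`_2 - th i.+1.
have L0 i : (i.+1 < d)%N -> L i = 0.
  move=> id; have n : th i - th i.+2 != 0.
    by rewrite subr_eq0; apply/eqP => /inj E; have := E _ id; lia.
  apply: (mulfI n).
  apply: (lincomb2 (Q0 i (ltnW id)) (Q0 i.+1 id) 1 (-1)).
  by rewrite /Q /L; ring.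
have h1 := L0 j (ltnW jd); have h2 := L0 j.+1 jd.
by apply: (lincomb2 h1 h2 (-1) 1); rewrite /L; ring.
Qed.

End PolyOfM.

Lemma eigenvalue_recurrence : (3 <= d)%N -> exists b, forall j, (j.+3 <= d)%N ->
  th j - th j.+3 = b * (th j.+1 - th j.+2) /\
  ths j - ths j.+3 = b * (ths j.+1 - ths j.+2).
Proof.
move=> d3.
(* Partial sums, so that the polynomial interpolating them satisfies [pth]. *)
pose z i := - \sum_(0 <= h < i) th h * th h.+1 * (th h - th h.+1).
have [p sp pz] := poly_interpolation z inj.
have pth i : (i < d)%N -> p.[th i] - p.[th i.+1] = th i * th i.+1 * (th i - th
  i.+1).
  by move=> id; rewrite (pz _ (ltnW id)) (pz _ id) /z big_nat_recr //=; ring.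
have p3 : p`_3 != 0.
  apply/eqP => p0; have := bracket_eigenvalues sp pth d3.
  rewrite p0 mul0r => /eqP; rewrite subr_eq0 => /eqP/inj E.
  by have := E (ltnW (ltnW d3)) (ltnW d3).
exists (p`_3)^-1 => j jd; split; apply: (mulfI p3); rewrite mulVKf //.
  by rewrite (bracket_eigenvalues sp pth).
by rewrite (bracket_corner sp pth).
Qed.

End Recurrence.

(** * Eigenvalue sequences with equal end differences *)

Section Reflection.
Variable F : fieldType.
Implicit Types (e a S x : F) (th : nat -> F) (d : nat).

(** Just what turns theta_(d-i) into the sequence with parameters (a + S, - S, x). It depends on e
    and d alone, hence survives the rescaling of x. *)
Definition reflective e d := forall i, (i <= d)%N ->
  symr e (d - i).+1 = 1 - symr e i.+1 /\
  symr e (d - i).+1 + chebU e (d - i).+1 = symr e i.+1 + chebU e i.+1.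

Lemma tseq_rev e d a S x i : reflective e d -> (i <= d)%N ->
  tseq e (a + S) (- S) x i.+1 = tseq e a S x (d - i).+1.
Proof.
by move=> rfl id; have [h1 h2] := rfl i id; rewrite /tseq h2 h1; ring.
Qed.

Lemma reflective_last e d : reflective e d ->
  symr e d.+1 = 1 /\ chebU e d.+1 = -1.
Proof.
move=> rfl; have [] := rfl 0 isT; rewrite subn0 => h1 h2.
rewrite h1 in h2 *; rewrite /symr /chebU /= in h2 *; split; first by ring.
by apply: (lincomb1 h2 1); ring.
Qed.

Lemma reflective_penult e d : (0 < d)%N -> reflective e d ->
  symr e d = 1 /\ chebU e d = 0.
Proof.
move=> d0 rfl; have [] := rfl 1 d0; rewrite subn1 prednK // => h1 h2.
rewrite h1 in h2 *; rewrite /symr /chebU /= in h2 *; split; first by ring.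
by apply: (lincomb1 h2 1); ring.
Qed.

Lemma reflective_neq0 e d : reflective e d -> e != 0.
Proof.
move=> /reflective_last[r1 _]; apply/eqP => e0; move: r1; rewrite e0.
have [-> _] : symr (0 : F) d.+1 = 0 /\ symr (0 : F) d.+2 = 0.
  elim: d.+1 => [|n [h1 h2]]; first by rewrite /symr /=; split; ring.
  by split=> //; rewrite symrSS h1 h2; ring.
by move/eqP; rewrite eq_sym oner_eq0.
Qed.

Definition second_order d b k th :=
  forall j, (j.+2 <= d)%N -> th j.+2 = b * th j.+1 - th j + k.

Lemma tseq_repr e d th : second_order d (2 - (e + e)) (e * (th 1%N + th d)) th
  ->
  forall i, (i <= d)%N -> th i = tseq e (th 0) (th d - th 0) (th 1%N - th 0)
    i.+1.
Proof.
move=> rec i.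
suff [] : ((i <= d)%N -> th i = tseq e (th 0) (th d - th 0) (th 1%N - th 0)
  i.+1) /\
  ((i.+1 <= d)%N -> th i.+1 = tseq e (th 0) (th d - th 0) (th 1%N - th 0) i.+2)
    by [].
elim: i => [|i [IH1 IH2]]; first by split=> _; rewrite ?tseq1 ?tseq2 //; ring.
split=> // id; rewrite rec // tseqSS -IH1 -?IH2 1?ltnW //; last exact: ltnW.
by rewrite /kappa; ring.
Qed.

Lemma second_order_rev d b k th :
  second_order d b k th -> second_order d b k (fun i => th (d - i)%N).
Proof.
move=> rec j jd; have := rec (d - j.+2)%N.
have -> : (d - j.+2).+2 = (d - j)%N by lia.
have -> : (d - j.+2).+1 = (d - j.+1)%N by lia.
move=> /(_ (leq_subr _ _)) h; apply: (lincomb1 h 1); ring.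
Qed.

Section Theta.
Variables (d : nat) (th : nat -> F) (b : F).
Hypotheses (d3 : (3 <= d)%N) (inj : inj_upto d th).
Hypothesis rec3 : forall j, (j.+3 <= d)%N ->
  th j - th j.+3 = (1 + b) * (th j.+1 - th j.+2).
Hypothesis ends : th 0 - th 1%N = th d - th d.-1.

Let k := th 0 - b * th 1%N + th 2.

Lemma second_order_theta : second_order d b k th.
Proof.
elim=> [|j IHj] jd; first by rewrite /k; ring.
have h1 := rec3 jd; have h2 := IHj (ltnW jd).
by apply: (lincomb2 h1 h2 (-1) 1); ring.
Qed.

(** Equating the first integral at 0 and at d - 1, where theta_(d-1) = theta_1 + theta_d - theta_0,
    gives this times theta_0 - theta_d. *)
Lemma double_kappa : k + k = (2 - b) * (th 1%N + th d).
Proof.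
pose Q j := th j ^+ 2 - b * th j * th j.+1 + th j.+1 ^+ 2 - k * (th j + th
  j.+1).
have QE j : (j < d)%N -> Q j = Q 0.
  elim: j => // j IHj jd; rewrite -(IHj (ltnW jd)) /Q.
  by rewrite (second_order_theta jd); ring.
have dE : d = d.-1.+1 by lia.
have d1 : (d.-1 < d)%N by rewrite -dE.
have h := QE _ d1; rewrite /Q -dE in h.
have n0 : th 0 - th d != 0.
  by rewrite subr_eq0; apply/eqP => /inj E; have := E isT (leqnn d); lia.
have tE : th d.-1 = th 1%N + th d - th 0 by rewrite -[th d.-1](subKr (th d))
  -ends; ring.
rewrite tE in h; apply: (mulfI n0).
by apply: (lincomb1 h 1); ring.
Qed.

(** Here [double_kappa] reads b (theta_1 + theta_d) = 0, and the second factor is theta_1 - theta_d,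
    not zero. For b = 0 the recurrence has period 4, so distinctness leaves only d = 3. *)
Lemma char2_collapse : 2 = 0 :> F -> [/\ b = 0, d = 3 & k = th 1%N + th d].
Proof.
move=> c2.
have t1d : th 1%N + th d != 0.
  have -> : th 1%N + th d = th 1%N - th d by apply: (lincomb1 c2 (th d)); ring.
  by rewrite subr_eq0; apply/eqP => /inj E; have := E _ (leqnn d); lia.
have b0 : b = 0.
  apply: (mulIf t1d); rewrite mul0r; have h := double_kappa.
  by apply: (lincomb2 h c2 1 (th 1%N + th d - k)); ring.
have r1 := second_order_theta (j := 1); have r2 := second_order_theta (j := 2).
have r0 := second_order_theta (j := 0).
rewrite b0 in r0 r1 r2.
have dE : d = 3.
  apply/eqP; rewrite eqn_leq d3 andbT leqNgt; apply/negP => d4.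
  have /inj E : th 4 = th 0.
    by rewrite (r2 d4) (r0 _) 1?ltnW // 1?ltnW //; ring.
  by have := E d4 isT.
split=> //; rewrite dE (r1 d3); ring.
Qed.

End Theta.

(* In characteristic 2 the hypotheses below force d = 3 and b = 0, whence e = 1. *)
Definition half_defect b : F := if 2 == 0 :> F then 1 else (2 - b) / 2.

Section Representation.
Variables (d : nat) (th : nat -> F) (b : F).
Hypotheses (d3 : (3 <= d)%N) (inj : inj_upto d th).
Hypothesis rec3 : forall j, (j.+3 <= d)%N ->
  th j - th j.+3 = (1 + b) * (th j.+1 - th j.+2).
Hypothesis ends : th 0 - th 1%N = th d - th d.-1.
Local Notation e := (half_defect b).

Lemma half_defectE : 2 - (e + e) = b.
Proof.
rewrite /half_defect; case: eqP => [c2|/eqP c2]; last by field.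
by have [-> _ _] := char2_collapse d3 inj rec3 ends c2; ring.
Qed.

Lemma second_order_half_defect :
  second_order d (2 - (e + e)) (e * (th 1%N + th d)) th.
Proof.
rewrite half_defectE.
suff -> : e * (th 1%N + th d) = th 0 - b * th 1%N + th 2.
  exact: second_order_theta.
rewrite /half_defect; case: eqP => [c2|/eqP c2].
  by have [_ _ ->] := char2_collapse d3 inj rec3 ends c2; rewrite mul1r.
have h := double_kappa d3 inj rec3 ends.
by apply: (mulfI c2); apply: (lincomb1 h (-1)); field.
Qed.

Lemma theta_tseq i : (i <= d)%N ->
  th i = tseq e (th 0) (th d - th 0) (th 1%N - th 0) i.+1.
Proof. exact: tseq_repr second_order_half_defect i. Qed.

(** The reversed sequence obeys the same recurrence, so it has a representation of its own.
    Comparing both at i and d - i, the sum and the difference give the two symmetries up to a factor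
    2; in characteristic 2 only d = 3, e = 1 remains to be computed. *)
Lemma theta_reflective : reflective e d.
Proof.
case: (eqVneq (2 : F) 0) => c2.
  have [b0 dE _] := char2_collapse d3 inj rec3 ends c2.
  have -> : e = 1 by rewrite /half_defect c2 eqxx.
  rewrite dE; case=> [|[|[|[|i]]]] //= _; rewrite /symr /chebU /=; split; ring.
have S0 : th d - th 0 != 0.
  by rewrite subr_eq0; apply/eqP => /inj E; have := E (leqnn d) isT; lia.
have x0 : th 1%N - th 0 != 0.
  by rewrite subr_eq0; apply/eqP => /inj E; have := E _ isT; lia.
have endsE : th d.-1 = th 1%N + th d - th 0.
  by rewrite -[th d.-1](subKr (th d)) -ends; ring.
have rev j : (j <= d)%N ->
    th (d - j)%N = tseq e (th d) (th 0 - th d) (th 1%N - th 0) j.+1.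
  have h := tseq_repr (e := e) (d := d) (th := fun i => th (d - i)%N).
  rewrite /= subn0 subnn subn1 in h; move=> jd.
  have := h _ j jd; rewrite endsE.
  have -> : th 1%N + th d - th 0 - th d = th 1%N - th 0 by ring.
  apply; have -> : th 1%N + th d - th 0 + th 0 = th 1%N + th d by ring.
  exact: second_order_rev second_order_half_defect.
move=> i id.
have h1 := theta_tseq id; have h2 := theta_tseq (leq_subr i d).
have h3 := rev _ id; have h4 := rev _ (leq_subr i d); rewrite subKn // in h4.
rewrite h1 /tseq in h4; rewrite h2 /tseq in h3.
split.
  apply: (mulfI S0); apply: (mulfI c2).
  by apply: (lincomb2 h3 h4 1 1); ring.
apply: (mulfI x0); apply: (mulfI c2).
by apply: (lincomb2 h3 h4 1 (-1)); ring.
Qed.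

End Representation.

End Reflection.

(** * The family *)

Section Generic.
Variable F : fieldType.
Implicit Types (P : F -> Prop).

Definition generic P := exists2 q : {poly F}, q != 0 & forall t,
  q.[t] != 0 -> P t.

Lemma generic_imp P1 P2 : (forall t, P1 t -> P2 t) -> generic P1 -> generic P2.
Proof. by move=> P12 [q q0 qP]; exists q => // t /qP /P12. Qed.

Lemma generic_and P1 P2 : generic P1 -> generic P2 -> generic (fun t => P1 t /\
  P2 t).
Proof.
move=> [q1 q10 qP1] [q2 q20 qP2]; exists (q1 * q2); first by rewrite mulf_neq0.
by move=> t; rewrite hornerM mulf_eq0 negb_or => /andP[/qP1 ? /qP2 ?].
Qed.

Lemma generic_forall n (P : nat -> F -> Prop) :
  (forall k, (k < n)%N -> generic (P k)) ->
  generic (fun t => forall k, (k < n)%N -> P k t).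
Proof.
elim: n => [|n IHn] gP; first by exists 1; rewrite ?oner_neq0.
have gn := IHn (fun k kn => gP k (ltnW kn)).
apply: generic_imp (generic_and gn (gP n (leqnn _))) => t [h1 h2] k.
by rewrite ltnS leq_eqVlt => /orP[/eqP ->|/h1].
Qed.

Lemma generic_quadratic (A B C t0 : F) : A + B * t0 + C * t0 ^+ 2 != 0 ->
  generic (fun t => A + B * t + C * t ^+ 2 != 0).
Proof.
pose q : {poly F} := A%:P + B *: 'X + C *: 'X^2.
have qE t : q.[t] = A + B * t + C * t ^+ 2 by rewrite /q !hornerE.
rewrite -qE => q0; exists q => [|t]; last by rewrite qE.
by apply: contraNneq q0 => ->; rewrite horner0.
Qed.

Lemma generic_neq0 : generic (fun t => t != 0).
Proof. by exists 'X; rewrite ?polyX_eq0 // => t; rewrite hornerX. Qed.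

End Generic.

Lemma generic_sequence (F : closedFieldType) (P : F -> Prop) : generic P ->
  exists2 f : nat -> F, injective f & forall n, P (f n).
Proof.
move=> [q q0 qP].
have /choice[g gP] : forall s : seq F, exists t, q.[t] != 0 /\ t \notin s.
  move=> s; have : q * \prod_(z <- s) ('X - z%:P) != 0.
    by rewrite mulf_neq0 // monic_neq0 // monic_prod_XsubC.
  move/closed_nonrootP => [t];
    rewrite rootM root_prod_XsubC negb_or => /andP[qt ts].
  by exists t.
(* [hist n] lists the first n chosen values, all avoided by the next choice. *)
pose hist := fix hist n := if n is n'.+1 then g (hist n') :: hist n' else [::].
exists (fun n => g (hist n)); last by move=> n; apply: qP; case: (gP (hist n)).
have mem m n : (m < n)%N -> g (hist m) \in hist n.
  elim: n => // n IHn; rewrite ltnS leq_eqVlt /= inE => /orP[/eqP ->|/IHn ->].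
    by rewrite eqxx.
  by rewrite orbT.
move=> m n E; have [mn|nm|//] := ltngtP m n.
  by have [_] := gP (hist n); rewrite -E mem.
by have [_] := gP (hist m); rewrite E mem.
Qed.

Section GenericParameters.
Variables (F : fieldType) (e : F) (d : nat).
Hypotheses (d3 : (3 <= d)%N) (rfl : reflective e d).

Lemma generic_inj a S x : inj_upto d (fun i => tseq e a S x i.+1) ->
  generic (fun t => inj_upto d (fun i => tseq e a S (t * x) i.+1)).
Proof.
move=> inj; set s := tseq e a S.
have gij i j : (i < j <= d)%N -> generic (fun t => s (t * x) i.+1 != s (t * x)
  j.+1).
  move=> /andP[ij jd].
  pose D0 := S * symr e i.+1 - S * symr e j.+1.
  pose D1 := x * (symr e i.+1 + chebU e i.+1) - x * (symr e j.+1 + chebU e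
    j.+1).
  apply: (generic_imp (P1 := fun t => D0 + D1 * t + 0 * t ^+ 2 != 0)).
    move=> t; apply: contraNN => /eqP st; apply/eqP; rewrite /s /tseq in st.
    by apply: (lincomb1 st 1); rewrite /D0 /D1; ring.
  (* At t = 1 the sequence is the given injective one. *)
  apply: (generic_quadratic (t0 := 1)); apply/eqP => E.
  have /inj E' : tseq e a S x i.+1 = tseq e a S x j.+1.
    by apply: (lincomb1 E 1); rewrite /tseq /D0 /D1; ring.
  by have := E' (ltnW (leq_trans ij jd)) jd => ji; rewrite ji ltnn in ij.
have := @generic_forall F d.+1 (fun j t => forall i,
  (i < d.+1)%N -> (i < j)%N ->
   s (t * x) i.+1 != s (t * x) j.+1).
case=> [j jd|q q0 qP].
  apply: generic_forall => i _; have [ij|ji] := ltnP i j.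
    have ijd : (i < j <= d)%N by rewrite ij.
    by apply: generic_imp (gij i j ijd).
  by exists 1; rewrite ?oner_neq0.
exists q => // t /qP st i j id jd E; have [ij|ji|//] := ltngtP i j.
  by have := st j jd i id ij; rewrite E eqxx.
by have := st i id j jd ji; rewrite E eqxx.
Qed.

Lemma generic_vphi a S x as_ Ss xs c :
  S != 0 -> Ss != 0 -> c - xs * S != 0 -> c + Ss * x != 0 ->
  (forall k, (1 < k < d)%N -> symr e k.+1 != 0 /\ symr e k != 1) ->
  generic (fun t => forall k, (0 < k <= d)%N ->
    vphi e a S (t * x) as_ Ss (t * xs) (t * c) k != 0).
Proof.
move=> S0 Ss0 c1 cd mid.
have gk k : (k < d.+1)%N -> generic (fun t => (0 < k)%N ->
    vphi e a S (t * x) as_ Ss (t * xs) (t * c) k != 0).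
  rewrite ltnS leq_eqVlt => /orP[/eqP ->|kd].
    apply: generic_imp (generic_neq0 F) => t t0 _.
    have -> : vphi e a S (t * x) as_ Ss (t * xs) (t * c) d = t * (c + Ss * x).
      have [r1 u1] := reflective_last rfl.
      have [|r2 u2] := reflective_penult _ rfl; first by lia.
      by rewrite /vphi /tseq r1 u1 r2 u2; ring.
    by rewrite mulf_neq0.
  case: k kd => [|[|k]] kd; first by exists 1; rewrite ?oner_neq0.
    apply: generic_imp (generic_neq0 F) => t t0 _.
    have -> : vphi e a S (t * x) as_ Ss (t * xs) (t * c) 1 = t * (c - xs * S).
      by rewrite vphi1; ring.
    by rewrite mulf_neq0.
  have [r0 r1] := mid k.+2 kd; set r := symr e k.+3 in r0;
    set r' := symr e k.+2 in r1.
  set u := chebU e k.+3; set u' := chebU e k.+2.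
  pose A := Ss * r * (S * (r' - 1)).
  pose B := c * (1 + u') + Ss * r * (x * (r' + u')) + xs * (r + u) * (S * (r' -
    1)).
  pose C := xs * (r + u) * (x * (r' + u')).
  apply: (generic_imp (P1 := fun t => A + B * t + C * t ^+ 2 != 0)) => [t h _|].
    suff -> : vphi e a S (t * x) as_ Ss (t * xs) (t * c) k.+2 = A + B * t + C *
      t ^+ 2 by [].
    by rewrite /vphi /tseq -/r -/r' -/u -/u' /A /B /C; ring.
  apply: (generic_quadratic (t0 := 0)).
  by rewrite mulr0 expr0n mulr0 !addr0 !mulf_neq0 // subr_eq0.
by apply: generic_imp (generic_forall gk) => t h k /andP[k0 kd]; apply: h.
Qed.

(** If r_k = 0 then U_k is 0 or 1, and theta_k equals theta_0 or theta_1. If r_(k-1) = 1 then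
    U_(k-1) is 0 or -1, and theta_(k-1) equals theta_(d-1) or theta_d. *)
Lemma symr_interior a S x : inj_upto d (fun i => tseq e a S x i.+1) ->
  forall k, (1 < k < d)%N -> symr e k.+1 != 0 /\ symr e k != 1.
Proof.
move=> inj k /andP[k1 kd]; have e0 := reflective_neq0 rfl.
have [rl ul] := reflective_last rfl.
have [|rp up] := reflective_penult _ rfl; first by lia.
have neq i j : (i <= d)%N -> (j <= d)%N -> i <> j ->
    tseq e a S x i.+1 <> tseq e a S x j.+1.
  by move=> id jd ij E; apply: ij; apply: inj.
split; apply/eqP => rk.
  case: (symr_eq0 e0 rk) => uk.
    by apply: (neq k 0); [lia| |lia|rewrite tseq1 /tseq rk uk; ring].
  by apply: (neq k 1); [lia|lia|lia|rewrite tseq2 /tseq rk uk; ring].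
have kE : k = k.-1.+1 by lia.
rewrite kE in rk; case: (symr_eq1 e0 rk) => uk.
  apply: (neq k.-1 d.-1); [lia|lia|lia|rewrite (_ : d.-1.+1 = d); last by lia].
  by rewrite /tseq rk uk rp up; ring.
by apply: (neq k.-1 d); [lia|lia|lia|rewrite /tseq rk uk rl ul; ring].
Qed.

End GenericParameters.

(** * End-entries and extreme split scalars of a Leonard system *)

Section SystemRelations.
Variables (F : closedFieldType) (d : nat) (Phi : leonard_system F d).
Local Notation th := (ls_theta Phi).
Local Notation ths := (ls_thetas Phi).
Local Notation a := (ls_a Phi).
Local Notation as_ := (ls_as Phi).

Lemma ls_theta_inj : inj_upto d th /\ inj_upto d ths.
Proof. by have [M [C [P [_ ? ? _ _]]]] := leonard_system_data Phi. Qed.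

Lemma ls_recurrence : (3 <= d)%N -> exists b, forall j, (j.+3 <= d)%N ->
  th j - th j.+3 = (1 + b) * (th j.+1 - th j.+2) /\
  ths j - ths j.+3 = (1 + b) * (ths j.+1 - ths j.+2).
Proof.
move=> d3; have [M [C [P [data inj injs _ _]]]] := leonard_system_data Phi.
have [b rec] := eigenvalue_recurrence data inj injs d3.
by exists (b - 1); rewrite addrC subrK.
Qed.

Lemma ls_end_relations : (0 < d)%N ->
  [/\ (a 0 - th 0) * (ths 0 - ths 1) = (as_ 0 - ths 0) * (th 0 - th 1),
      (a 0 - th d) * (ths 0 - ths 1) = (as_ d - ths 0) * (th d - th d.-1),
      (a d - th 0) * (ths d - ths d.-1) = (as_ 0 - ths d) * (th 0 - th 1)
    & (a d - th d) * (ths d - ths d.-1) = (as_ d - ths d) * (th d - th d.-1)].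
Proof.
move=> d0; have [M [C [P [data _ _ aE _]]]] := leonard_system_data Phi.
pose i1 : 'I_d.+1 := Ordinal (d0 : 1 < d.+1)%N.
have dp : (d.-1 < d.+1)%N by lia.
have e0 : endpoint (ord0 : 'I_d.+1) i1 by left.
have ed : endpoint (ord_max : 'I_d.+1) (Ordinal dp) by right; rewrite /= prednK.
have [a0 as0] := aE ord0; have [ad asd] := aE ord_max.
have R := endpoint_relation data.
by have := (R _ _ _ _ e0 e0, R _ _ _ _ e0 ed, R _ _ _ _ ed e0, R _ _ _ _ ed ed);
  rewrite -a0 -ad -as0 -asd => -[[[? ?] ?] ?].
Qed.

Lemma ls_end_neq : (0 < d)%N ->
  [/\ a 0 != th 0, a 0 != th d, a d != th 0 & a d != th d].
Proof.
move=> d0; have [M [C [P [data _ _ aE _]]]] := leonard_system_data Phi.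
pose i1 : 'I_d.+1 := Ordinal (d0 : 1 < d.+1)%N.
have dp : (d.-1 < d.+1)%N by lia.
have e0 : endpoint (ord0 : 'I_d.+1) i1 by left.
have ed : endpoint (ord_max : 'I_d.+1) (Ordinal dp) by right; rewrite /= prednK.
have [a0 _] := aE ord0; have [ad _] := aE ord_max.
have R := endpoint_neq_eigenvalue data.
by have := (R _ _ _ _ e0 e0, R _ _ _ _ e0 ed, R _ _ _ _ ed e0, R _ _ _ _ ed ed);
  rewrite -a0 -ad => -[[[? ?] ?] ?].
Qed.

Lemma ls_split_ends : (0 < d)%N ->
  [/\ ls_varphi Phi 1 = (ths 0 - ths 1) * (a 0 - th 0),
      ls_phi Phi 1 = (ths 0 - ths 1) * (a 0 - th d),
      ls_varphi Phi d = (as_ d - ths d) * (th d - th d.-1)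
    & ls_phi Phi d = (as_ 0 - ths d) * (th 0 - th 1)].
Proof.
move=> d0; have [M [C [P [data inj injs aE tE]]]] := leonard_system_data Phi.
pose i1 : 'I_d.+1 := Ordinal (d0 : 1 < d.+1)%N.
have dp : (d.-1 < d.+1)%N by lia.
have e0 : endpoint (ord0 : 'I_d.+1) i1 by left.
have ed : endpoint (ord_max : 'I_d.+1) (Ordinal dp) by right; rewrite /= prednK.
have [a0 as0] := aE ord0; have [ad asd] := aE ord_max.
have nat_neq (i j : 'I_d.+1) : i != j -> nat_of_ord i <> j.
  by move=> /eqP ij E; apply/ij/val_inj.
have first s : split_trace Phi s 1 / split_trace Phi s 0 = a 0 - s 0.
  by rewrite !tE big_nat1 big_geq // !mxE eqxx divr1 -a0.
split.
- by rewrite /ls_varphi first.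
- by rewrite /ls_phi first subn0.
- rewrite /ls_varphi !tE (split_trace_ratio data injs d0 ed) ?asd //=.
    move=> k /nat_neq kd /nat_neq kd1; exists (nat_of_ord k) => //=.
    by have := ltn_ord k; move: kd kd1 => /=; lia.
  by move=> h hd; apply/eqP => /inj E; have := E _ (leqnn d); lia.
- rewrite /ls_phi !tE (split_trace_ratio data injs d0 e0) ?as0 //=.
  + move=> k /nat_neq k0 /nat_neq k1; exists (d - k)%N.
      by have := ltn_ord k; move: k0 k1 => /=; lia.
    by rewrite subKn // -ltnS.
  + by move=> h hd; apply/eqP => /inj E; have := E (leq_subr _ _) isT; lia.
  + by congr th; lia.
Qed.

Lemma ls_betaE b : (3 <= d)%N ->
  (forall j, (j.+3 <= d)%N ->
     th j - th j.+3 = (1 + b) * (th j.+1 - th j.+2) /\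
     ths j - ths j.+3 = (1 + b) * (ths j.+1 - ths j.+2)) ->
  ls_beta Phi = b.
Proof.
move=> d3 rec; have [inj injs] := ls_theta_inj.
have ratio s j : inj_upto d s -> (j.+3 <= d)%N ->
    s j - s j.+3 = (1 + b) * (s j.+1 - s j.+2) ->
    (s j - s j.+3) / (s j.+1 - s j.+2) = b + 1.
  move=> injs' jd ->; rewrite mulfK ?[b + 1]addrC // subr_eq0.
  by apply/eqP => /injs' E; have := E _ _; lia.
apply: xget_unique => /= [i /andP[i2 id]|b'].
  case: i i2 id => [|[|j]] //= _ jd; have jd3 : (j.+3 <= d)%N by lia.
  by have [h1 h2] := rec j jd3; rewrite !subSS subn0; split; apply: ratio.
move=> /(_ 2) []; first by lia.
by rewrite subnn (ratio _ 0) ?(rec _ d3).1 // => /addIr ->.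
Qed.

End SystemRelations.

(** An isomorphism carries an eigenvector in E_i V to one in E'_i V'. This makes theta_1 an
    invariant that separates the members of the family. *)
Lemma isomorphic_theta (F : closedFieldType) d (Phi Psi : leonard_system F d) i
  :
  ls_isomorphic Phi Psi -> ls_theta Phi i = ls_theta Psi i.
Proof.
move=> [s [bij sA _ sE _]]; rewrite /ls_theta; move: (inord i) => {}i.
have [b [t [[bb _ _] _ fb tE Eb]]] := standard_eigenbasis (ls_standard Phi).
have [b' [t' [[bb' _ _] injt' fb' tE' Eb']]] := standard_eigenbasis
  (ls_standard Psi).
rewrite tE tE'.
have vE : ls_E Psi i (s (tnth b i)) = s (tnth b i).
  by rewrite -comp_lfunE -sE comp_lfunE Eb eqxx.
have vA : ls_A Psi (s (tnth b i)) = t i *: s (tnth b i).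
  by rewrite -comp_lfunE -sA comp_lfunE fb linearZ.
have Ev v : ls_E Psi i v = coord b' i v *: tnth b' i.
  rewrite {1}(coord_expand bb' v) linear_sum (bigD1 i) //= linearZ /= Eb' eqxx.
  rewrite big1 ?addr0 // => j /negPf ji.
  by rewrite linearZ /= Eb' eq_sym ji scaler0.
have w0 : s (tnth b i) != 0.
  apply: contraNneq (tnth_basis_neq0 bb i) => w0.
  by apply/eqP/(bij_inj bij); rewrite w0 linear0.
apply/eqP; rewrite -subr_eq0; move: w0; apply: contraNT => tt.
rewrite -[_ == 0](orFb) -(negPf tt) -scaler_eq0 scalerBl -vA -{1 2}vE !Ev.
by rewrite linearZ /= fb' !scalerA mulrC subrr.
Qed.

(** The four conditions on c say that phi_1, varphi_1, varphi_d and phi_d are nonzero at t = 1. The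
    final equation, which is varphi_1 = (theta*_0 - theta*_1)(a_0 - theta_0), serves to recover
    a_0. *)
Lemma generic_leonard_system (F : closedFieldType) d e (a S x as_ Ss xs c : F) :
  (3 <= d)%N -> reflective e d ->
  inj_upto d (fun i => tseq e a S x i.+1) ->
  inj_upto d (fun i => tseq e as_ Ss xs i.+1) ->
  S != 0 -> Ss != 0 ->
  c != 0 -> c - xs * S != 0 -> c + Ss * x != 0 -> c - xs * S + Ss * x != 0 ->
  generic (fun t => t != 0 /\ exists Psi : leonard_system F d,
    [/\ forall i, (i <= d)%N -> ls_theta Psi i = tseq e a S (t * x) i.+1,
        forall i, (i <= d)%N -> ls_thetas Psi i = tseq e as_ Ss (t * xs) i.+1
      & (a - ls_a Psi 0) * (t * xs) = t * (c - xs * S)]).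
Proof.
move=> d3 rfl inj injs S0 Ss0 c0 c1 c2 c3.
have mid := symr_interior d3 rfl inj.
have d0 : (0 < d)%N by lia.
have [rl ul] := reflective_last rfl.
have g1 := generic_inj inj; have g2 := generic_inj injs.
have g3 := generic_vphi d3 rfl a as_ S0 Ss0 c1 c2 mid.
have g4 : generic (fun t => forall k, (0 < k <= d)%N ->
    vphi e (a + S) (- S) (t * x) as_ Ss (t * xs) (t * (c - xs * S)) k != 0).
  apply: generic_vphi; rewrite ?oppr_eq0 //.
  by have -> : c - xs * S - xs * - S = c by ring.
have g5 : generic (fun t => forall k, (0 < k <= d)%N ->
    vphi e (as_ + Ss) (- Ss) (t * xs) a S (t * x) (t * (c - xs * S)) k != 0).
  apply: generic_vphi; rewrite ?oppr_eq0 //.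
    by have -> : c - xs * S - x * - Ss = c - xs * S + Ss * x by ring.
  by have -> : c - xs * S + S * xs = c by ring.
apply: generic_imp (generic_and (generic_neq0 F) (generic_and (generic_and g1
  g2)
  (generic_and g3 (generic_and g4 g5)))) => t [t0 [[h1 h2] [h3 [h4 h5]]]].
split=> //.
have [M [C [P [data M00]]]] : exists M C P : 'M[F]_d.+1,
    leonard_data (fun i => tseq e a S (t * x) i.+1)
      (fun i => tseq e as_ Ss (t * xs) i.+1) M C P /\
    (a - M ord0 ord0) * (t * xs) = t * c - t * xs * S.
  apply: (@leonard_data_exists _ e a S (t * x) as_ Ss (t * xs) (t * c)) => //.
  - by move=> i; apply: tseq_rev.
  - by move=> i; apply: tseq_rev.
  - move=> k /h4; have -> // : t * (c - xs * S) = t * c - t * xs * S by ring.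
  - move=> k /h5.
    have -> // : t * (c - xs * S) = t * c - t * xs * S + Ss * (t * x) - t * x *
      Ss by ring.
have [Psi [thE thsE aE]] := leonard_system_of_data data h1 h2.
by exists Psi; split=> //; rewrite aE M00; ring.
Qed.

Lemma leonard_systems_with_ends (F : closedFieldType) d (th ths : nat -> F)
    (b a0 ad as0 asd : F) :
  (3 <= d)%N -> inj_upto d th -> inj_upto d ths ->
  (forall j, (j.+3 <= d)%N ->
     th j - th j.+3 = (1 + b) * (th j.+1 - th j.+2) /\
     ths j - ths j.+3 = (1 + b) * (ths j.+1 - ths j.+2)) ->
  (a0 - th 0) * (ths 0 - ths 1) = (as0 - ths 0) * (th 0 - th 1) ->
  (a0 - th d) * (ths 0 - ths 1) = (asd - ths 0) * (th d - th d.-1) ->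
  (ad - th 0) * (ths d - ths d.-1) = (as0 - ths d) * (th 0 - th 1) ->
  (ad - th d) * (ths d - ths d.-1) = (asd - ths d) * (th d - th d.-1) ->
  a0 != th 0 -> a0 != th d -> ad != th 0 -> ad != th d ->
  (ths 0 - ths 1) * (a0 - th 0) + (asd - ths d) * (th d - th d.-1)
  = (ths 0 - ths 1) * (a0 - th d) + (as0 - ths d) * (th 0 - th 1) ->
  exists Psi : nat -> leonard_system F d,
    (forall m n, m <> n -> ls_theta (Psi m) 1 <> ls_theta (Psi n) 1) /\
    forall n, ls_beta (Psi n) = b /\
      ls_end_entries (Psi n)
      = [:: th 0; th d; ths 0; ths d; a0; ad; as0; asd].
Proof.
move=> hd inj injs rec R00 R0d Rd0 Rdd n00 n0d nd0 ndd hPhi.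
have d0 : (0 < d)%N by apply: leq_trans hd.
have dn0 : d <> 0%N by move=> dE; rewrite dE in d0.
have neq s i j : inj_upto d s -> (i <= d)%N -> (j <= d)%N -> i <> j -> s i - s
  j != 0 :> F.
  by move=> injs' id jd ij; rewrite subr_eq0; apply/eqP => /injs' E; apply/ij/E.
have S0 : th d - th 0 != 0 by apply: neq.
have Ss0 : ths d - ths 0 != 0 by apply: neq.
have x0 : th 1 - th 0 != 0 by apply: neq.
have xs0 : ths 1 - ths 0 != 0 by apply: neq.
(* varphi_1 - phi_1 is (theta_d - theta_0)(theta*_0 - theta*_1), and the relations at a_d turn phi_d
   - varphi_d into (theta_d - theta_0)(theta*_d - theta*_(d-1)). *)
have ends_s : ths 0 - ths 1 = ths d - ths d.-1.
  apply: (mulfI S0).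
  by apply: (lincomb3 hPhi Rdd Rd0 1 1 (-1)); ring.
(* The same for varphi_1 - phi_d and varphi_d - phi_1, through the relations at a_0. *)
have ends : th 0 - th 1 = th d - th d.-1.
  apply: (mulfI Ss0).
  by apply: (lincomb3 hPhi R00 R0d 1 (-1) 1); ring.
have rec1 j (jd : (j.+3 <= d)%N) := (rec j jd).1.
have rec2 j (jd : (j.+3 <= d)%N) := (rec j jd).2.
pose e := half_defect b.
have be : 2 - (e + e) = b by apply: (half_defectE hd inj rec1 ends).
have rfl : reflective e d := theta_reflective hd inj rec1 ends.
have thE : forall i, (i <= d)%N -> th i = tseq e _ _ _ i.+1 := theta_tseq hd
  inj rec1 ends.
have thsE : forall i, (i <= d)%N -> ths i = tseq e _ _ _ i.+1 := theta_tseq hd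
  injs rec2 ends_s.
set S := th d - th 0 in S0 thE; set x := th 1 - th 0 in x0 thE.
set Ss := ths d - ths 0 in Ss0 thsE; set xs := ths 1 - ths 0 in xs0 thsE.
(* This is phi_1; then c - xs S, c + Ss x and c - xs S + Ss x are varphi_1, varphi_d and phi_d. *)
pose c := - xs * (a0 - th d).
have asd0 : asd - ths d != 0.
  apply: contraTneq (mulf_neq0 (_ : ad - th d != 0) (_ : ths d - ths d.-1 !=
    0)) => [E||].
  - by rewrite Rdd E mul0r eqxx.
  - by rewrite subr_eq0.
  - by rewrite -ends_s -opprB oppr_eq0.
have as00 : as0 - ths d != 0.
  apply: contraTneq (mulf_neq0 (_ : ad - th 0 != 0) (_ : ths d - ths d.-1 !=
    0)) => [E||].
  - by rewrite Rd0 E mul0r eqxx.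
  - by rewrite subr_eq0.
  - by rewrite -ends_s -opprB oppr_eq0.
have c0 : c != 0 by rewrite mulf_neq0 ?oppr_eq0 // subr_eq0.
have c1E : c - xs * S = - xs * (a0 - th 0) by rewrite /c /S; ring.
have c2E : c + Ss * x = - x * (asd - ths d).
  by apply: (lincomb2 R0d ends 1 (ths 0 - asd)); rewrite /c /Ss /x /xs; ring.
have c3E : c - xs * S + Ss * x = - x * (as0 - ths d).
  by apply: (lincomb1 R00 1); rewrite /c /Ss /x /xs /S; ring.
have c1 : c - xs * S != 0.
  by rewrite c1E; apply: mulf_neq0; rewrite ?oppr_eq0 // subr_eq0.
have c2 : c + Ss * x != 0 by rewrite c2E; apply: mulf_neq0; rewrite ?oppr_eq0.
have c3 : c - xs * S + Ss * x != 0.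
  by rewrite c3E; apply: mulf_neq0; rewrite ?oppr_eq0.
have inj1 : inj_upto d (fun i => tseq e (th 0) S x i.+1).
  by move=> i j id jd; rewrite -!thE //; apply: inj.
have injs1 : inj_upto d (fun i => tseq e (ths 0) Ss xs i.+1).
  by move=> i j id jd; rewrite -!thsE //; apply: injs.
have [f injf fP] := generic_sequence
  (generic_leonard_system hd rfl inj1 injs1 S0 Ss0 c0 c1 c2 c3).
have /choice[Psi PsiP] := fun n => (fP n).2.
exists Psi; split=> [m n mn thE1|n].
  have [thm _ _] := PsiP m; have [thn _ _] := PsiP n.
  move: thE1; rewrite thm ?thn // !tseq2 => /addrI.
  by move/(mulIf x0)/injf.
have [t0 _] := fP n; have [] := PsiP n.
move: (Psi n) (f n) t0 => {Psi PsiP f injf fP n} Psi t t0 th' ths' a0'.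
split.
  apply: ls_betaE => // j jd.
  have j2 := ltnW jd; have j1 := ltnW j2; have j0 := ltnW j1.
  rewrite !th' ?ths' //.
  by rewrite -be !(tseqSS _ _ _ _ j.+2) !(tseqSS _ _ _ _ j.+1); split; ring.
have [r1 u1] := reflective_last rfl; have [r2 u2] := reflective_penult d0 rfl.
have dE : d.-1.+1 = d by rewrite prednK.
have tx0 : t * x != 0 by rewrite mulf_neq0.
have txs0 : t * xs != 0 by rewrite mulf_neq0.
have [] := ls_end_relations Psi d0.
rewrite !th' ?ths' ?leq_pred // !tseq1 !tseq2 !dE.
have endE (z y w : F) : tseq e z y w d = z + y + w /\ tseq e z y w d.+1 = z + y.
  by rewrite /tseq r1 u1 r2 u2; split; ring.
rewrite !(endE _ _ _).1 !(endE _ _ _).2 => Q00 Q0d _ Qdd.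
have aE : ls_a Psi 0 = a0.
  by apply: (mulIf txs0); apply: (lincomb1 a0' (-1)); rewrite c1E; ring.
have asE : ls_as Psi 0 = as0.
  apply: (mulIf tx0); rewrite aE in Q00.
  by apply: (lincomb2 Q00 R00 1 (- t)); rewrite /x /xs; ring.
have asdE : ls_as Psi d = asd.
  apply: (mulIf tx0); rewrite aE in Q0d.
  by apply: (lincomb3 Q0d R0d ends 1 (- t) (t * (asd - ths 0)));
    rewrite /x /xs /S; ring.
have adE : ls_a Psi d = ad.
  apply: (mulIf txs0); rewrite asdE in Qdd.
  apply: (lincomb4 Qdd Rdd ends ends_s (-1) t (t * (ths d - asd)) (t * (ad - th
    d))).
  by rewrite /x /xs /S /Ss; ring.
rewrite /ls_end_entries aE asE asdE adE !th' ?ths' // !tseq1 !(endE _ _ _).2.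
have -> : th 0 + S = th d by rewrite /S addrC subrK.
by have -> : ths 0 + Ss = ths d by rewrite /Ss addrC subrK.
Qed.

Theorem theorem1p12 (F : closedFieldType) (d : nat) (hd : (3 <= d)%N)
    (Phi : leonard_system F d)
    (hPhi : ls_varphi Phi 1 + ls_varphi Phi d = ls_phi Phi 1 + ls_phi Phi d) :
  exists Psi : nat -> leonard_system F d,
    (forall m n : nat, m <> n -> ~ ls_isomorphic (Psi m) (Psi n)) /\
    (forall n : nat,
       ls_beta (Psi n) = ls_beta Phi /\
       ls_end_entries (Psi n) = ls_end_entries Phi).
Proof.
have d0 : (0 < d)%N by apply: leq_trans hd.
have [inj injs] := ls_theta_inj Phi.
have [b rec] := ls_recurrence Phi hd.
have [R00 R0d Rd0 Rdd] := ls_end_relations Phi d0.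
have [n00 n0d nd0 ndd] := ls_end_neq Phi d0.
have [v1 p1 vd pd] := ls_split_ends Phi d0.
rewrite v1 p1 vd pd in hPhi.
have [Psi [neq ends]] := leonard_systems_with_ends hd inj injs rec
  R00 R0d Rd0 Rdd n00 n0d nd0 ndd hPhi.
exists Psi; split=> [m n mn iso|n].
  exact: neq mn (isomorphic_theta 1 iso).
have [betaE endE] := ends n; split; last exact: endE.
exact: etrans betaE (esym (ls_betaE hd rec)).
Qed.
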